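(* Let $\alpha>0$ and $\varepsilon_\alpha:=\frac{1}{4\alpha^2}$. There exists $\delta>0$ such that for all $\varepsilon\in(\varepsilon_\alpha-\delta,\varepsilon_\alpha+\delta)$ the boundary value problem $$\frac{1}{u\sqrt{1+u'^2}}\frac{d}{dx}\Bigl(\frac{u}{\sqrt{1+u'^2}}H'\Bigr)+\frac12 H\Bigl(\frac{u''}{(1+u'^2)^{3/2}}+\frac{1}{u\sqrt{1+u'^2}}\Bigr)^2-2\varepsilon H=0 \ \text{ in } (-1,1),\qquad u(\pm1)=\alpha,\ u'(\pm1)=0,$$ has a smooth family (in $\varepsilon$) of solutions $u_\varepsilon\in N_\alpha\cap C^\infty([-1,1])$.
   Context: Here, for a positive $C^2$ function $u$ on $[-1,1]$, $H(x):=\frac12\Bigl(\frac{1}{u(x)\sqrt{1+u'(x)^2}}-\frac{u''(x)}{(1+u'(x)^2)^{3/2}}\Bigr)$ is the mean curvature of the surface of revolution generated by $u$. For $\alpha>0$, $N_\alpha:=\{u\in H^2(-1,1): u \text{ even},\ u>0 \text{ on } [-1,1],\ u(\pm1)=\alpha,\ u'(\pm1)=0\}$. *)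

(* Defs.v *)
From Stdlib Require Import Reals.
From Coquelicot Require Import Coquelicot.
Open Scope R_scope.

Definition I11 (x : R) : Prop := -1 <= x <= 1.

Definition has_deriv_on_I (g g' : R -> R) : Prop :=
  forall x, I11 x ->
    filterlim (fun y => (g y - g x) / (y - x))
      (within (fun y => I11 y /\ y <> x) (locally x)) (locally (g' x)).

(* d is the sequence of successive derivatives of g on [-1,1] (d 0 = g);
   g admits such a sequence iff g is in C^infty([-1,1]). *)
Definition deriv_seq_I (g : R -> R) (d : nat -> R -> R) : Prop :=
  d 0%nat = g /\ forall n, has_deriv_on_I (d n) (d (S n)).

(* u belongs to N_alpha \cap C^infty([-1,1]).  (Membership in H^2(-1,1)
   is implied by C^infty([-1,1]).) *)
Definition in_N_alpha_Cinf (alpha : R) (u : R -> R) : Prop :=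
  exists d : nat -> R -> R,
    deriv_seq_I u d /\
    (forall x, I11 x -> u (- x) = u x) /\
    (forall x, I11 x -> 0 < u x) /\
    u 1 = alpha /\ u (-1) = alpha /\
    d 1%nat 1 = 0 /\ d 1%nat (-1) = 0.

(* Mean curvature H of the surface of revolution generated by u. *)
Definition mean_curv (u : R -> R) (x : R) : R :=
  / 2 * (/ (u x * sqrt (1 + (Derive u x) ^ 2))
         - Derive (Derive u) x / (sqrt (1 + (Derive u x) ^ 2)) ^ 3).

Definition willmore_lhs (eps : R) (u : R -> R) (x : R) : R :=
  let H := mean_curv u in
  / (u x * sqrt (1 + (Derive u x) ^ 2))
    * Derive (fun y => u y / sqrt (1 + (Derive u y) ^ 2) * Derive H y) x
  + / 2 * H x * (Derive (Derive u) x / (sqrt (1 + (Derive u x) ^ 2)) ^ 3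
                 + / (u x * sqrt (1 + (Derive u x) ^ 2))) ^ 2
  - 2 * eps * H x.

(* Joint C^infty regularity of a two-parameter family f e x on a set D
   (one-sided derivatives at boundary points of D): F w is the iterated
   partial derivative of f along the word w (true = d/dx, false = d/de),
   every F w is jointly continuous on D. *)
Definition partial_x_on (D : R -> R -> Prop) (f g : R -> R -> R) : Prop :=
  forall e x, D e x ->
    filterlim (fun y => (f e y - f e x) / (y - x))
      (within (fun y => D e y /\ y <> x) (locally x)) (locally (g e x)).

Definition partial_e_on (D : R -> R -> Prop) (f g : R -> R -> R) : Prop :=
  forall e x, D e x ->
    filterlim (fun s => (f s x - f e x) / (s - e))
      (within (fun s => D s x /\ s <> e) (locally e)) (locally (g e x)).

Definition cont2_on (D : R -> R -> Prop) (f : R -> R -> R) : Prop :=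
  forall e x, D e x ->
    filterlim (fun p : R * R => f (fst p) (snd p))
      (within (fun p : R * R => D (fst p) (snd p)) (locally (e, x)))
      (locally (f e x)).

Definition Cinf2_on (D : R -> R -> Prop) (f : R -> R -> R) : Prop :=
  exists F : list bool -> R -> R -> R,
    F nil = f /\
    (forall w, cont2_on D (F w)) /\
    (forall w, partial_x_on D (F w) (F (cons true w))) /\
    (forall w, partial_e_on D (F w) (F (cons false w))).

(* Main.v *)
(* Write u = alpha + v, eps = eps_alpha + d and kappa = 1 / alpha^4.  After
   clearing denominators the equation is polynomial in d and in v and its first
   four derivatives, and its linearization at the cylinder is v'''' + kappa v,
   which is invertible on even functions with v = v' = 0 at 1 (variation of
   parameters).  With g := v'''' + kappa v as unknown this is a fixed-point
   equation whose right-hand side is of second order when d has weight 2.  It is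
   solved by contraction among the functions of (d, x) that are absolutely
   convergent sums of monomials on |d| < rho, |x| < 2: there products and
   integration in x are bounded, while Cauchy estimates give joint smoothness in
   (eps, x) up to x = -1 and x = 1. *)
Require Import Defs.
From Stdlib Require Import Reals Lra Lia List.
From Coquelicot Require Import Coquelicot.
Open Scope R_scope.

(** * Sums of monomials *)

(** The parameter belongs to the function space: one contraction acts on functions of [(d, x)], so
    regularity in [d] comes with the fixed point and no implicit function theorem is invoked. The
    unknown is [g] rather than [v] because [v] and its first three derivatives are integral
    operators of [g], while the fourth is [g - kappa v] algebraically; nothing is differentiated
    during the iteration, which therefore stays on one radius, whereas differentiating a power
    series shrinks its disc. The weight 2 of [d] comes from the residual of the cylinder: at [v = 0]
    the normalized polynomial equals [2 d / alpha], of first order in [d], and it counts as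
    quadratic once [rho] is the square of the size of [v]. Without denominators and roots only sums
    and products remain, which [normed] controls directly. Evenness leaves two homogeneous solutions
    for the two conditions at [1] and carries these to [-1]. A radius above [1] makes the endpoints
    interior, so one-sided derivatives are restrictions of ordinary ones. *)

(* Closing under countable sums, instead of asking for a single series of
   monomials, makes products and limits free of double-series rearrangements. *)
Inductive normed (rho r : R) : (R -> R -> R) -> R -> Prop :=
| normed_monomial (f : R -> R -> R) (a : R) (p q : nat) (S : R) :
    Rabs a * rho ^ p * r ^ q <= S ->
    (forall d x, Rabs d < rho -> Rabs x < r -> f d x = a * d ^ p * x ^ q) ->
    normed rho r f S
| normed_series (f : nat -> R -> R -> R) (F : R -> R -> R) (M : nat -> R) (S T : R) :
    (forall k, normed rho r (f k) (M k)) ->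
    is_series M S -> S <= T ->
    (forall d x, Rabs d < rho -> Rabs x < r -> is_series (fun k => f k d x) (F d x)) ->
    normed rho r F T.

Lemma normed_ext (rho r : R) (f g : R -> R -> R) (M : R) :
  (forall d x, Rabs d < rho -> Rabs x < r -> f d x = g d x) ->
  normed rho r f M -> normed rho r g M.
Proof.
intros Hfg Hf; destruct Hf as [f a p q S HS Hf | f F M S T Hf HM HST HF].
- apply (normed_monomial _ _ _ a p q); [exact HS|].
  intros d x Hd Hx; rewrite <- Hfg by assumption; auto.
- apply (normed_series _ _ f _ M S); auto.
  intros d x Hd Hx; rewrite <- Hfg by assumption; auto.
Qed.

Lemma normed_le (rho r : R) (f : R -> R -> R) (M M' : R) :
  M <= M' -> normed rho r f M -> normed rho r f M'.
Proof.
intros HM Hf; destruct Hf as [f a p q S HS Hf | f F M0 S T Hf HM0 HST HF].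
- apply (normed_monomial _ _ _ a p q); [lra|assumption].
- apply (normed_series _ _ f _ M0 S); auto; lra.
Qed.

Lemma normed_restrict (rho r rho' r' : R) (f : R -> R -> R) (M : R) :
  0 <= rho' <= rho -> 0 <= r' <= r ->
  normed rho r f M -> normed rho' r' f M.
Proof.
intros Hrho Hr Hf; induction Hf as [f a p q S HS Hf | f F M S T Hf IH HM HST HF].
- apply (normed_monomial _ _ _ a p q).
  + eapply Rle_trans; [|exact HS].
    assert (0 <= rho' ^ p) by (apply pow_le; lra).
    assert (0 <= r' ^ q) by (apply pow_le; lra).
    apply Rmult_le_compat; auto.
    * apply Rmult_le_pos; [apply Rabs_pos|auto].
    * apply Rmult_le_compat_l; [apply Rabs_pos|apply pow_incr; lra].
    * apply pow_incr; lra.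
  + intros d x Hd Hx; apply Hf; lra.
- apply (normed_series _ _ f _ M S); auto.
  intros d x Hd Hx; apply HF; lra.
Qed.

(** Monomials treat [d] and [x] alike, so every estimate proved in [x] also serves in [d]. *)
Lemma normed_swap (rho r : R) (f : R -> R -> R) (M : R) :
  normed rho r f M -> normed r rho (fun x d => f d x) M.
Proof.
intros Hf; induction Hf as [f a p q S HS Hf | f F M S T Hf IH HM HST HF].
- apply (normed_monomial _ _ _ a q p).
  + lra.
  + intros d x Hd Hx; rewrite Hf by assumption; ring.
- apply (normed_series _ _ (fun k x d => f k d x) _ M S); auto.
Qed.

Lemma is_series_Rle (a b : nat -> R) (la lb : R) :
  (forall n, a n <= b n) -> is_series a la -> is_series b lb -> la <= lb.
Proof.
intros Hab Ha Hb.
apply (is_lim_seq_le (sum_n a) (sum_n b) la lb); auto.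
intros n; rewrite !sum_n_Reals; apply sum_Rle; auto.
Qed.

Lemma is_series_Rabs_le (a b : nat -> R) (la lb : R) :
  (forall n, Rabs (a n) <= b n) -> is_series a la -> is_series b lb -> Rabs la <= lb.
Proof.
intros Hab Ha Hb; apply Rabs_le; split.
- apply (is_series_Rle (fun n => - b n) a); auto.
  + intros n; specialize (Hab n); apply Rabs_le_between in Hab; lra.
  + apply (is_series_opp b); exact Hb.
- apply (is_series_Rle a b); auto.
  intros n; specialize (Hab n); apply Rabs_le_between in Hab; lra.
Qed.

Lemma ex_series_Rabs_le (a b : nat -> R) :
  (forall n, Rabs (a n) <= b n) -> ex_series b -> ex_series a.
Proof. intros Hab Hb; exact (ex_series_le a b Hab Hb). Qed.

Lemma normed_bound (rho r : R) (f : R -> R -> R) (M : R) :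
  normed rho r f M ->
  forall d x, Rabs d < rho -> Rabs x < r -> Rabs (f d x) <= M.
Proof.
intros Hf; induction Hf as [f a p q S HS Hf | f F M S T Hf IH HM HST HF]; intros d x Hd Hx.
- rewrite Hf by assumption; eapply Rle_trans; [|exact HS].
  rewrite !Rabs_mult, <- !RPow_abs.
  assert (Hdp := Rabs_pos d). assert (Hxp := Rabs_pos x).
  apply Rmult_le_compat.
  + apply Rmult_le_pos; [apply Rabs_pos|apply pow_le; auto].
  + apply pow_le; auto.
  + apply Rmult_le_compat_l; [apply Rabs_pos|apply pow_incr; lra].
  + apply pow_incr; lra.
- apply Rle_trans with S; auto.
  apply (is_series_Rabs_le (fun k => f k d x) M); auto.
Qed.

Lemma normed_pos (rho r : R) (f : R -> R -> R) (M : R) :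
  0 < rho -> 0 < r -> normed rho r f M -> 0 <= M.
Proof.
intros Hrho Hr Hf.
eapply Rle_trans; [apply Rabs_pos|].
apply (normed_bound _ _ _ _ Hf 0 0); rewrite Rabs_R0; lra.
Qed.

Lemma normed_const (rho r c : R) : normed rho r (fun _ _ => c) (Rabs c).
Proof.
apply (normed_monomial _ _ _ c 0 0); simpl; [lra|intros; ring].
Qed.

Lemma normed_zero (rho r M : R) : 0 <= M -> normed rho r (fun _ _ => 0) M.
Proof.
intros HM; apply normed_le with (Rabs 0); [rewrite Rabs_R0; auto|apply normed_const].
Qed.

(** Padding with zeros turns a binary sum into a series, the only form of summation that [normed]
    offers. *)
Lemma is_series_pair (a b : R) :
  is_series (fun k => match k with 0%nat => a | 1%nat => b | _ => 0 end) (a + b).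
Proof.
set (u := fun k : nat => _).
change (is_lim_seq (sum_n u) (a + b)).
apply (is_lim_seq_ext_loc (fun _ => a + b)); [|apply is_lim_seq_const].
exists 1%nat; intros n Hn.
induction n as [|[|n] IH]; [lia| |].
- rewrite sum_Sn, sum_O; reflexivity.
- rewrite sum_Sn, <- IH by lia; unfold plus; simpl; ring.
Qed.

Lemma normed_plus (rho r : R) (f g : R -> R -> R) (M M' : R) :
  normed rho r f M -> normed rho r g M' ->
  normed rho r (fun d x => f d x + g d x) (M + M').
Proof.
intros Hf Hg.
apply (normed_series _ _
  (fun k => match k with 0%nat => f | 1%nat => g | _ => fun _ _ => 0 end) _
  (fun k => match k with 0%nat => M | 1%nat => M' | _ => 0 end) (M + M')).
- intros [|[|k]]; auto; apply normed_zero; lra.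
- apply is_series_pair.
- lra.
- intros d x _ _; eapply is_series_ext; [|apply is_series_pair].
  intros [|[|k]]; reflexivity.
Qed.

(** Two nested inductions replace a Cauchy product: the outer one unfolds [f] down to a monomial
    with [g] fixed, the inner one unfolds [g] against that monomial. Each level only multiplies a
    convergent series by a fixed factor. *)
Lemma normed_mult (rho r : R) (f g : R -> R -> R) (M M' : R) :
  0 < rho -> 0 < r ->
  normed rho r f M -> normed rho r g M' ->
  normed rho r (fun d x => f d x * g d x) (M * M').
Proof.
intros Hrho Hr Hf Hg.
assert (HM' := normed_pos _ _ _ _ Hrho Hr Hg).
induction Hf as [f a p q S HS Hf | f F M S T Hf IH HM HST HF].
- assert (Hrp : 0 < rho ^ p) by (apply pow_lt; auto).
  assert (Hrq : 0 < r ^ q) by (apply pow_lt; auto).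
  assert (HA : 0 <= Rabs a * rho ^ p * r ^ q).
  { apply Rmult_le_pos; [apply Rmult_le_pos; [apply Rabs_pos|]|]; lra. }
  induction Hg as [g b p' q' S' HS' Hg | g G M' S' T' Hg IH HM1 HST' HG].
  + apply (normed_monomial _ _ _ (a * b) (p + p') (q + q')).
    * rewrite Rabs_mult, !pow_add.
      replace (Rabs a * Rabs b * (rho ^ p * rho ^ p') * (r ^ q * r ^ q'))
        with ((Rabs a * rho ^ p * r ^ q) * (Rabs b * rho ^ p' * r ^ q')) by ring.
      apply Rmult_le_compat; auto.
      apply Rmult_le_pos; [apply Rmult_le_pos; [apply Rabs_pos|]|];
        left; apply pow_lt; auto.
    * intros d x Hd Hx; rewrite Hf, Hg by assumption; rewrite !pow_add; ring.
  + apply (normed_series _ _ (fun k d x => f d x * g k d x) _ (fun k => S * M' k) (S * S')).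
    * intros k; apply IH; exact (normed_pos _ _ _ _ Hrho Hr (Hg k)).
    * apply (is_series_scal_l S M'); exact HM1.
    * apply Rmult_le_compat_l; lra.
    * intros d x Hd Hx; apply (is_series_scal_l (f d x) (fun k => g k d x)); auto.
- apply (normed_series _ _ (fun k d x => f k d x * g d x) _ (fun k => M k * M') (S * M')).
  + exact IH.
  + rewrite Rmult_comm; eapply is_series_ext; [|apply (is_series_scal_l M' M); exact HM].
    intros n; apply Rmult_comm.
  + apply Rmult_le_compat_r; lra.
  + intros d x Hd Hx; rewrite Rmult_comm.
    eapply is_series_ext; [|apply (is_series_scal_l (g d x) (fun k => f k d x)); auto].
    intros n; apply Rmult_comm.
Qed.

Lemma normed_scal (rho r c : R) (f : R -> R -> R) (M : R) :
  0 < rho -> 0 < r -> normed rho r f M ->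
  normed rho r (fun d x => c * f d x) (Rabs c * M).
Proof.
intros Hrho Hr Hf; apply (normed_mult _ _ (fun _ _ => c)); auto.
apply normed_const.
Qed.

Lemma normed_minus (rho r : R) (f g : R -> R -> R) (M M' : R) :
  0 < rho -> 0 < r -> normed rho r f M -> normed rho r g M' ->
  normed rho r (fun d x => f d x - g d x) (M + M').
Proof.
intros Hrho Hr Hf Hg.
apply (normed_ext _ _ (fun d x => f d x + -1 * g d x)); [intros; ring|].
apply normed_plus; auto.
apply normed_le with (Rabs (-1) * M').
- replace (-1) with (- (1)) by ring; rewrite Rabs_Ropp, Rabs_R1; lra.
- apply normed_scal; auto.
Qed.

(** The boundary corrections in [clamped] involve values at [1]; they have to stay in the class as
    functions of [d] that are constant in [x]. *)
Lemma normed_eval (rho r x0 : R) (f : R -> R -> R) (M : R) :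
  0 < rho -> Rabs x0 < r -> normed rho r f M -> normed rho r (fun d _ => f d x0) M.
Proof.
intros Hrho Hx0 Hf; induction Hf as [f a p q S HS Hf | f F M S T Hf IH HM HST HF].
- apply (normed_monomial _ _ _ (a * x0 ^ q) p 0).
  + eapply Rle_trans; [|exact HS].
    rewrite Rabs_mult, <- RPow_abs; simpl.
    replace (Rabs a * Rabs x0 ^ q * rho ^ p * 1) with (Rabs a * rho ^ p * Rabs x0 ^ q) by ring.
    apply Rmult_le_compat_l.
    * apply Rmult_le_pos; [apply Rabs_pos|apply pow_le; lra].
    * apply pow_incr; split; [apply Rabs_pos|lra].
  + intros d x Hd Hx; rewrite Hf by assumption; simpl; ring.
- apply (normed_series _ _ (fun k d x => f k d x0) _ M S); auto.
Qed.

(** * Cauchy estimates: derivatives and Lipschitz bounds *)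

(** The bound depends on [q] only through [r ^ q], so it can be summed against the majorant of a
    series. With [b q = r ^ q / (r - s)] the induction closes because [b (S q) = s * b q + r ^ q]
    exactly, mirroring the product rule for [x * x ^ q]. *)
Lemma pow_deriv_bound (s r x : R) (q : nat) :
  s < r -> Rabs x <= s -> Rabs (INR q * x ^ pred q) <= r ^ q / (r - s).
Proof.
intros Hsr Hx. assert (Hx0 := Rabs_pos x).
assert (Hd : 0 < / (r - s)) by (apply Rinv_0_lt_compat; lra).
induction q as [|q IH].
- simpl; rewrite Rmult_0_l, Rabs_R0; unfold Rdiv; lra.
- rewrite S_INR; simpl pred.
  replace ((INR q + 1) * x ^ q) with (x * (INR q * x ^ pred q) + x ^ q)
    by (destruct q; simpl; ring).
  eapply Rle_trans; [apply Rabs_triang|].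
  rewrite Rabs_mult, <- RPow_abs.
  replace (r ^ S q / (r - s)) with (s * (r ^ q / (r - s)) + r ^ q) by (simpl; field; lra).
  apply Rplus_le_compat.
  + apply Rmult_le_compat; auto; apply Rabs_pos.
  + apply pow_incr; lra.
Qed.

(** The same recursion one order higher: multiplying the remainder for [q] by [x + h] leaves [h ^ 2]
    times the derivative, which [pow_deriv_bound] controls. *)
Lemma pow_taylor_bound (s r x h : R) (q : nat) :
  s < r -> Rabs x <= s -> Rabs (x + h) <= s ->
  Rabs ((x + h) ^ q - x ^ q - h * (INR q * x ^ pred q)) <= h ^ 2 * (r ^ q / (r - s) ^ 2).
Proof.
intros Hsr Hx Hxh.
assert (Hx0 := Rabs_pos x).
assert (Hd : 0 < / (r - s)) by (apply Rinv_0_lt_compat; lra).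
induction q as [|q IH].
- simpl; rewrite Rmult_0_l, Rmult_0_r, !Rminus_diag, Rabs_R0.
  apply Rmult_le_pos; [nra|].
  unfold Rdiv; rewrite Rmult_1_l; left; apply Rinv_0_lt_compat; nra.
- replace ((x + h) ^ S q - x ^ S q - h * (INR (S q) * x ^ pred (S q)))
    with ((x + h) * ((x + h) ^ q - x ^ q - h * (INR q * x ^ pred q))
          + h ^ 2 * (INR q * x ^ pred q))
    by (rewrite S_INR; destruct q; simpl; ring).
  eapply Rle_trans; [apply Rabs_triang|].
  rewrite !Rabs_mult, (Rabs_pos_eq (h ^ 2)) by nra.
  replace (h ^ 2 * (r ^ S q / (r - s) ^ 2))
    with (s * (h ^ 2 * (r ^ q / (r - s) ^ 2)) + h ^ 2 * (r ^ q / (r - s)))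
    by (simpl; field; lra).
  apply Rplus_le_compat.
  + apply Rmult_le_compat; auto; apply Rabs_pos.
  + apply Rmult_le_compat_l; [nra|].
    rewrite <- Rabs_mult; apply pow_deriv_bound; auto.
Qed.

(** A remainder bounded by a multiple of [h ^ 2] can be summed termwise; this recovers the
    derivative of a series from the summed bound. *)
Lemma is_derive_quadratic (f : R -> R) (x l c e : R) :
  0 < e ->
  (forall h, Rabs h < e -> Rabs (f (x + h) - f x - h * l) <= c * h ^ 2) ->
  is_derive f x l.
Proof.
intros He Hf; apply is_derive_Reals; intros eps Heps.
assert (Hc : 0 < Rabs c + 1) by (assert (H := Rabs_pos c); lra).
assert (Hm : 0 < Rmin e (eps / (Rabs c + 1))).
{ apply Rmin_pos; auto; apply Rdiv_lt_0_compat; auto. }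
exists (mkposreal _ Hm); intros h Hh0 Hh; simpl in Hh.
assert (Hh1 := Rlt_le_trans _ _ _ Hh (Rmin_l _ _)).
assert (Hh2 := Rlt_le_trans _ _ _ Hh (Rmin_r _ _)).
specialize (Hf h Hh1).
assert (Hpos : 0 < Rabs h) by (apply Rabs_pos_lt; auto).
replace ((f (x + h) - f x) / h - l) with ((f (x + h) - f x - h * l) / h) by (field; auto).
unfold Rdiv; rewrite Rabs_mult, Rabs_inv.
apply (Rmult_lt_reg_r (Rabs h)); auto.
rewrite Rmult_assoc, Rinv_l, Rmult_1_r by lra.
eapply Rle_lt_trans; [exact Hf|].
apply Rmult_lt_compat_r with (r := Rabs c + 1) in Hh2; auto.
unfold Rdiv in Hh2; rewrite Rmult_assoc, Rinv_l, Rmult_1_r in Hh2 by lra.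
replace (h ^ 2) with (Rabs h * Rabs h) by (rewrite <- Rabs_mult; rewrite Rabs_pos_eq by nra; ring).
assert (c <= Rabs c) by apply Rle_abs.
nra.
Qed.

Lemma Rabs_lt_nbhd (x r : R) :
  Rabs x < r -> 0 < r - Rabs x /\ forall h, Rabs h < r - Rabs x -> Rabs (x + h) < r.
Proof.
intros Hx; split; [lra|]; intros h Hh.
eapply Rle_lt_trans; [apply Rabs_triang|lra].
Qed.

(* Cauchy estimates: shrinking the disc from [r] to [s] costs [1 / (r - s)]
   for the derivative and [1 / (r - s) ^ 2] for the Taylor remainder. *)
Lemma normed_deriv_remainder (rho r s : R) (f : R -> R -> R) (M : R) :
  0 < rho -> 0 < s < r -> normed rho r f M ->
  normed rho s (fun d x => Derive (f d) x) (M / (r - s)) /\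
  forall d x h, Rabs d < rho -> Rabs x < s -> Rabs (x + h) < s ->
    Rabs (f d (x + h) - f d x - h * Derive (f d) x) <= M / (r - s) ^ 2 * h ^ 2.
Proof.
intros Hrho Hs Hf.
assert (Hd0 : 0 < / (r - s)) by (apply Rinv_0_lt_compat; lra).
assert (Hd2 : 0 < / (r - s) ^ 2) by (apply Rinv_0_lt_compat; nra).
induction Hf as [f a p q S HS Hf | f F M S T Hf IH HM HST HF].
- assert (HA : 0 <= Rabs a * rho ^ p).
  { apply Rmult_le_pos; [apply Rabs_pos|apply pow_le; lra]. }
  assert (HD : forall d x, Rabs d < rho -> Rabs x < s ->
            Derive (f d) x = a * d ^ p * (INR q * x ^ pred q)).
  { intros d x Hd Hx.
    rewrite (Derive_ext_loc _ (fun x => a * d ^ p * x ^ q)).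
    - apply is_derive_unique; auto_derive; auto; ring.
    - destruct (Rabs_lt_nbhd x s Hx) as [He Hn].
      exists (mkposreal _ He); intros y Hy; apply Hf; auto.
      replace y with (x + (y - x)) by ring.
      apply Rlt_trans with s; [|lra]; apply Hn; exact Hy. }
  split.
  + apply (normed_monomial _ _ _ (a * INR q) p (pred q)).
    * replace (Rabs (a * INR q) * rho ^ p * s ^ pred q)
        with (Rabs a * rho ^ p * Rabs (INR q * s ^ pred q)).
      -- apply Rle_trans with (Rabs a * rho ^ p * (r ^ q / (r - s))).
         ++ apply Rmult_le_compat_l; auto.
            apply pow_deriv_bound; [lra|rewrite Rabs_pos_eq; lra].
         ++ unfold Rdiv; rewrite <- Rmult_assoc.
            apply Rmult_le_compat_r; lra.
      -- rewrite !Rabs_mult, (Rabs_pos_eq (s ^ pred q)) by (apply pow_le; lra); ring.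
    * intros d x Hd Hx; rewrite HD by assumption; ring.
  + intros d x h Hd Hx Hxh; rewrite HD, !Hf by lra.
    replace (a * d ^ p * (x + h) ^ q - a * d ^ p * x ^ q - h * (a * d ^ p * (INR q * x ^ pred q)))
      with (a * d ^ p * ((x + h) ^ q - x ^ q - h * (INR q * x ^ pred q))) by ring.
    rewrite Rabs_mult.
    apply Rle_trans with (Rabs a * rho ^ p * (h ^ 2 * (r ^ q / (r - s) ^ 2))).
    * apply Rmult_le_compat; try apply Rabs_pos.
      -- rewrite Rabs_mult; apply Rmult_le_compat_l; [apply Rabs_pos|].
         rewrite <- RPow_abs; apply pow_incr; split; [apply Rabs_pos|lra].
      -- apply pow_taylor_bound; lra.
    * replace (Rabs a * rho ^ p * (h ^ 2 * (r ^ q / (r - s) ^ 2)))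
        with (Rabs a * rho ^ p * r ^ q * (/ (r - s) ^ 2 * h ^ 2)) by (field; lra).
      replace (S / (r - s) ^ 2 * h ^ 2) with (S * (/ (r - s) ^ 2 * h ^ 2)) by (field; lra).
      apply Rmult_le_compat_r; [nra|auto].
- assert (HMs : forall c, is_series (fun k => M k * c) (S * c)).
  { intros c; rewrite Rmult_comm.
    eapply is_series_ext; [|apply (is_series_scal_l c M); exact HM].
    intros n; apply Rmult_comm. }
  assert (HsD : forall d x, Rabs d < rho -> Rabs x < s ->
            ex_series (fun k => Derive (f k d) x)).
  { intros d x Hd Hx; apply (ex_series_Rabs_le _ (fun k => M k / (r - s))).
    - intros k; apply (normed_bound _ _ _ _ (proj1 (IH k)) d x); auto.
    - eexists; apply HMs. }
  (* The quadratic remainders of the terms are summed against the majorant. This identifies the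
     derivative of [F d] with the sum of the derivatives, which is why both halves of the statement
     go through one induction. *)
  assert (Hrem : forall d x h, Rabs d < rho -> Rabs x < s -> Rabs (x + h) < s ->
            Rabs (F d (x + h) - F d x - h * Series (fun k => Derive (f k d) x))
            <= S / (r - s) ^ 2 * h ^ 2).
  { intros d x h Hd Hx Hxh.
    apply (is_series_Rabs_le
      (fun k => f k d (x + h) - f k d x - h * Derive (f k d) x)
      (fun k => M k / (r - s) ^ 2 * h ^ 2)).
    - intros k; apply (proj2 (IH k)); auto.
    - apply (is_series_minus (fun k => f k d (x + h) - f k d x)
               (fun k => h * Derive (f k d) x)).
      + apply (is_series_minus (fun k => f k d (x + h)) (fun k => f k d x));
          apply HF; lra.
      + apply (is_series_scal_l h (fun k => Derive (f k d) x)).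
        apply Series_correct; auto.
    - unfold Rdiv; rewrite Rmult_assoc.
      eapply is_series_ext; [|apply HMs].
      intros n; simpl; symmetry; apply Rmult_assoc. }
  assert (HD : forall d x, Rabs d < rho -> Rabs x < s ->
            Derive (F d) x = Series (fun k => Derive (f k d) x)).
  { intros d x Hd Hx; apply is_derive_unique.
    destruct (Rabs_lt_nbhd x s Hx) as [He Hn].
    apply (is_derive_quadratic _ _ _ (S / (r - s) ^ 2) (s - Rabs x)); auto. }
  split.
  + apply (normed_series _ _ (fun k d x => Derive (f k d) x) _ (fun k => M k / (r - s))
             (S / (r - s))).
    * intros k; apply (proj1 (IH k)).
    * apply HMs.
    * apply Rmult_le_compat_r; lra.
    * intros d x Hd Hx; rewrite HD by assumption; apply Series_correct; auto.
  + intros d x h Hd Hx Hxh; rewrite HD by assumption.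
    eapply Rle_trans; [apply Hrem; auto|].
    apply Rmult_le_compat_r; [nra|]; apply Rmult_le_compat_r; lra.
Qed.

Lemma normed_Derive_x (rho r s : R) (f : R -> R -> R) (M : R) :
  0 < rho -> 0 < s < r -> normed rho r f M ->
  normed rho s (fun d x => Derive (f d) x) (M / (r - s)).
Proof. intros Hrho Hs Hf; apply (normed_deriv_remainder _ _ _ _ _ Hrho Hs Hf). Qed.

Lemma normed_ex_derive_x (rho r : R) (f : R -> R -> R) (M d x : R) :
  normed rho r f M -> Rabs d < rho -> Rabs x < r -> ex_derive (f d) x.
Proof.
intros Hf Hd Hx.
assert (Hdp := Rabs_pos d). assert (Hxp := Rabs_pos x).
assert (Hx' : Rabs x < (Rabs x + r) / 2) by lra.
destruct (Rabs_lt_nbhd _ _ Hx') as [He Hn].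
destruct (normed_deriv_remainder rho r ((Rabs x + r) / 2) f M) as [_ H]; auto; try lra.
eexists; eapply (is_derive_quadratic _ _ _ _ _ He).
intros h Hh; apply H; auto.
Qed.

Lemma normed_continuous_x (rho r : R) (f : R -> R -> R) (M d x : R) :
  normed rho r f M -> Rabs d < rho -> Rabs x < r -> continuous (f d) x.
Proof.
intros Hf Hd Hx; apply (ex_derive_continuous (f d)).
apply (normed_ex_derive_x _ _ _ _ _ _ Hf Hd Hx).
Qed.

Lemma pow_diff_bound (s r x y : R) (q : nat) :
  s < r -> Rabs x <= s -> Rabs y <= s ->
  Rabs (x ^ q - y ^ q) <= Rabs (x - y) * (r ^ q / (r - s)).
Proof.
intros Hsr Hx Hy.
assert (Hx0 := Rabs_pos x). assert (Hy0 := Rabs_pos y).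
assert (Hd : 0 < / (r - s)) by (apply Rinv_0_lt_compat; lra).
induction q as [|q IH].
- simpl; rewrite Rminus_diag, Rabs_R0; unfold Rdiv.
  apply Rmult_le_pos; [apply Rabs_pos|lra].
- replace (x ^ S q - y ^ S q) with (x * (x ^ q - y ^ q) + (x - y) * y ^ q) by (simpl; ring).
  eapply Rle_trans; [apply Rabs_triang|].
  rewrite !Rabs_mult, <- RPow_abs.
  replace (Rabs (x - y) * (r ^ S q / (r - s)))
    with (s * (Rabs (x - y) * (r ^ q / (r - s))) + Rabs (x - y) * r ^ q)
    by (simpl; field; lra).
  apply Rplus_le_compat.
  + apply Rmult_le_compat; auto; apply Rabs_pos.
  + apply Rmult_le_compat_l; [apply Rabs_pos|apply pow_incr; lra].
Qed.

(** Together with [normed_swap] it gives Lipschitz bounds in both variables, hence joint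
    continuity. *)
Lemma normed_lipschitz_x (rho r s : R) (f : R -> R -> R) (M d x y : R) :
  0 < rho -> s < r -> normed rho r f M ->
  Rabs d < rho -> Rabs x <= s -> Rabs y <= s ->
  Rabs (f d x - f d y) <= Rabs (x - y) * (M / (r - s)).
Proof.
intros Hrho Hs Hf Hd Hx Hy.
assert (Hd0 : 0 < / (r - s)) by (apply Rinv_0_lt_compat; lra).
induction Hf as [f a p q S HS Hf | f F M S T Hf IH HM HST HF].
- rewrite !Hf by lra.
  replace (a * d ^ p * x ^ q - a * d ^ p * y ^ q) with (a * d ^ p * (x ^ q - y ^ q)) by ring.
  rewrite !Rabs_mult, <- RPow_abs.
  apply Rle_trans with (Rabs a * rho ^ p * (Rabs (x - y) * (r ^ q / (r - s)))).
  + apply Rmult_le_compat; try apply Rabs_pos.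
    * apply Rmult_le_pos; [apply Rabs_pos|apply pow_le, Rabs_pos].
    * apply Rmult_le_compat_l; [apply Rabs_pos|].
      apply pow_incr; split; [apply Rabs_pos|lra].
    * apply pow_diff_bound; auto.
  + replace (Rabs a * rho ^ p * (Rabs (x - y) * (r ^ q / (r - s))))
      with (Rabs (x - y) * (Rabs a * rho ^ p * r ^ q / (r - s))) by (field; lra).
    apply Rmult_le_compat_l; [apply Rabs_pos|].
    apply Rmult_le_compat_r; lra.
- apply Rle_trans with (Rabs (x - y) * (S / (r - s))).
  + apply (is_series_Rabs_le (fun k => f k d x - f k d y) (fun k => Rabs (x - y) * (M k / (r - s)))); auto.
    * apply (is_series_minus (fun k => f k d x) (fun k => f k d y)); apply HF; lra.
    * apply (is_series_scal_l (Rabs (x - y)) (fun k => M k / (r - s))).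
      unfold Rdiv; rewrite Rmult_comm.
      eapply is_series_ext; [|apply (is_series_scal_l (/ (r - s)) M); exact HM].
      intros n; apply Rmult_comm.
  + apply Rmult_le_compat_l; [apply Rabs_pos|apply Rmult_le_compat_r; lra].
Qed.

(** * Integration in [x] *)

Definition prim (f : R -> R -> R) (d x : R) : R := RInt (f d) 0 x.

Lemma Rabs_between_0 (x z r : R) : Rmin 0 x <= z <= Rmax 0 x -> Rabs x < r -> Rabs z < r.
Proof.
intros Hz Hx; apply Rabs_def2 in Hx; apply Rabs_def1;
  revert Hz; unfold Rmin, Rmax; destruct (Rle_dec 0 x); lra.
Qed.

Lemma normed_ex_RInt (rho r : R) (f : R -> R -> R) (M d x : R) :
  normed rho r f M -> Rabs d < rho -> Rabs x < r -> ex_RInt (f d) 0 x.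
Proof.
intros Hf Hd Hx; apply (ex_RInt_continuous (f d)); intros z Hz.
apply (normed_continuous_x _ _ _ _ _ _ Hf Hd), (Rabs_between_0 x); auto.
Qed.

Lemma Rabs_RInt_0_le (f : R -> R) (x c : R) :
  ex_RInt f 0 x -> (forall z, Rmin 0 x <= z <= Rmax 0 x -> Rabs (f z) <= c) ->
  Rabs (RInt f 0 x) <= Rabs x * c.
Proof.
intros Hex Hc; unfold Rmin, Rmax in Hc; destruct (Rle_dec 0 x) as [H|H].
- rewrite (Rabs_pos_eq x) by auto.
  replace (x * c) with ((x - 0) * c) by ring; apply abs_RInt_le_const; auto.
- rewrite <- Rabs_Ropp, (Rabs_left x) by lra.
  assert (Hsw := opp_RInt_swap f 0 x Hex); change (- RInt f 0 x = RInt f x 0) in Hsw.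
  rewrite Hsw.
  replace (- x * c) with ((0 - x) * c) by ring; apply abs_RInt_le_const; auto; try lra.
  apply ex_RInt_swap; auto.
Qed.

(** On the whole disc the remainder after the partial sum of rank [n] is at most [S - sum_n M n], so
    the integrals differ by at most [Rabs x] times that, which tends to 0. *)
Lemma is_series_prim (rho r : R) (f : nat -> R -> R -> R) (F : R -> R -> R) (M : nat -> R)
    (S T d x : R) :
  (forall k, normed rho r (f k) (M k)) -> is_series M S -> normed rho r F T ->
  (forall d x, Rabs d < rho -> Rabs x < r -> is_series (fun k => f k d x) (F d x)) ->
  Rabs d < rho -> Rabs x < r ->
  is_series (fun k => prim (f k) d x) (prim F d x).
Proof.
intros Hf HM HnF HF Hd Hx.
assert (Hrho : 0 < rho) by (assert (H := Rabs_pos d); lra).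
assert (Hr : 0 < r) by (assert (H := Rabs_pos x); lra).
assert (Hsum : forall n,
  is_RInt (fun y => sum_n (fun k => f k d y) n) 0 x (sum_n (fun k => prim (f k) d x) n)).
{ induction n as [|n IH].
  - rewrite sum_O; apply is_RInt_ext with (f 0%nat d).
    + intros y _; rewrite sum_O; reflexivity.
    + apply (RInt_correct (f 0%nat d)), (normed_ex_RInt _ _ _ _ _ _ (Hf 0%nat)); auto.
  - rewrite sum_Sn.
    apply is_RInt_ext with (fun y => plus (sum_n (fun k => f k d y) n) (f (Datatypes.S n) d y)).
    + intros y _; rewrite sum_Sn; reflexivity.
    + apply (is_RInt_plus (fun y => sum_n (fun k => f k d y) n)); auto.
      apply (RInt_correct (f (Datatypes.S n) d)), (normed_ex_RInt _ _ _ _ _ _ (Hf (Datatypes.S n))); auto. }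
assert (HMp : forall k, 0 <= M k) by (intros k; exact (normed_pos _ _ _ _ Hrho Hr (Hf k))).
assert (Htail : forall n y, Rabs y < r ->
  Rabs (F d y - sum_n (fun k => f k d y) n) <= S - sum_n M n).
{ intros n y Hy.
  apply (is_series_Rabs_le (fun k => f (Datatypes.S n + k)%nat d y) (fun k => M (Datatypes.S n + k)%nat)).
  - intros k; apply (normed_bound _ _ _ _ (Hf _)); auto.
  - apply (is_series_incr_n (fun k => f k d y) (Datatypes.S n)); [lia|].
    simpl pred; unfold plus; simpl; rewrite Rplus_comm, Rplus_minus; auto.
  - apply (is_series_incr_n M (Datatypes.S n)); [lia|].
    simpl pred; unfold plus; simpl; rewrite Rplus_comm, Rplus_minus; auto. }
assert (Hdiff : forall n,
  Rabs (prim F d x - sum_n (fun k => prim (f k) d x) n) <= Rabs x * (S - sum_n M n)).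
{ intros n.
  assert (His : is_RInt (fun y => F d y - sum_n (fun k => f k d y) n) 0 x
            (prim F d x - sum_n (fun k => prim (f k) d x) n)).
  { apply (is_RInt_minus (F d)); auto.
    apply (RInt_correct (F d)), (normed_ex_RInt _ _ _ _ _ _ HnF); auto. }
  rewrite <- (is_RInt_unique _ _ _ _ His).
  apply Rabs_RInt_0_le; [eexists; exact His|].
  intros z Hz; apply Htail, (Rabs_between_0 x); auto. }
change (is_lim_seq (sum_n (fun k => prim (f k) d x)) (prim F d x)).
assert (HS : is_lim_seq (sum_n M) S) by exact HM.
apply (is_lim_seq_le_le
  (fun n => prim F d x - Rabs x * (S - sum_n M n)) _
  (fun n => prim F d x + Rabs x * (S - sum_n M n))).
- intros n; specialize (Hdiff n); apply Rabs_le_between in Hdiff; lra.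
- replace (Finite (prim F d x)) with (Finite (prim F d x - Rabs x * (S - S))) by (f_equal; ring).
  apply is_lim_seq_minus'; [apply is_lim_seq_const|].
  apply (is_lim_seq_scal_l (fun n => S - sum_n M n) (Rabs x) (S - S)).
  apply is_lim_seq_minus'; auto; apply is_lim_seq_const.
- replace (Finite (prim F d x)) with (Finite (prim F d x + Rabs x * (S - S))) by (f_equal; ring).
  apply is_lim_seq_plus'; [apply is_lim_seq_const|].
  apply (is_lim_seq_scal_l (fun n => S - sum_n M n) (Rabs x) (S - S)).
  apply is_lim_seq_minus'; auto; apply is_lim_seq_const.
Qed.

(** Integration turns [x ^ q] into [x ^ (q + 1) / (q + 1)]: it costs a factor at most [r] and does
    not shrink the disc, in contrast with differentiation. *)
Lemma normed_prim (rho r : R) (f : R -> R -> R) (M : R) :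
  0 < rho -> 0 < r -> normed rho r f M -> normed rho r (prim f) (r * M).
Proof.
intros Hrho Hr Hf; induction Hf as [f a p q S HS Hf | f F M S T Hf IH HM HST HF].
- apply (normed_monomial _ _ _ (a / INR (Datatypes.S q)) p (Datatypes.S q)).
  + assert (Hq : 1 <= INR (Datatypes.S q)) by (rewrite S_INR; assert (H := pos_INR q); lra).
    unfold Rdiv; rewrite Rabs_mult, Rabs_inv, (Rabs_pos_eq (INR _)) by lra.
    assert (Hi : / INR (Datatypes.S q) <= 1) by (rewrite <- Rinv_1; apply Rinv_le_contravar; lra).
    assert (0 <= Rabs a * rho ^ p * r ^ q).
    { apply Rmult_le_pos; [apply Rmult_le_pos; [apply Rabs_pos|]|]; apply pow_le; lra. }
    assert (0 < / INR (Datatypes.S q)) by (apply Rinv_0_lt_compat; lra).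
    replace (Rabs a * / INR (Datatypes.S q) * rho ^ p * r ^ Datatypes.S q)
      with (/ INR (Datatypes.S q) * (r * (Rabs a * rho ^ p * r ^ q))) by (simpl; ring).
    apply Rle_trans with (1 * (r * (Rabs a * rho ^ p * r ^ q))).
    * apply Rmult_le_compat_r; auto; apply Rmult_le_pos; lra.
    * rewrite Rmult_1_l; apply Rmult_le_compat_l; lra.
  + intros d x Hd Hx; unfold prim.
    apply is_RInt_unique.
    apply is_RInt_ext with (fun y => a * d ^ p * y ^ q).
    * intros y Hy; symmetry; apply Hf; auto.
      apply (Rabs_between_0 x); auto; lra.
    * replace (a / INR (Datatypes.S q) * d ^ p * x ^ Datatypes.S q)
        with (minus (a / INR (Datatypes.S q) * d ^ p * x ^ Datatypes.S q)
                    (a / INR (Datatypes.S q) * d ^ p * 0 ^ Datatypes.S q))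
        by (unfold minus, plus, opp; simpl; ring).
      assert (INR (Datatypes.S q) <> 0) by (apply not_0_INR; lia).
      apply (is_RInt_derive (fun x => a / INR (Datatypes.S q) * d ^ p * x ^ Datatypes.S q)).
      -- intros y _; auto_derive; auto.
         simpl pred; field; auto.
      -- intros y _; apply (ex_derive_continuous (fun y => a * d ^ p * y ^ q)).
         auto_derive; auto.
- apply (normed_series _ _ (fun k => prim (f k)) _ (fun k => r * M k) (r * S)); auto.
  + apply (is_series_scal_l r M); exact HM.
  + apply Rmult_le_compat_l; lra.
  + intros d x Hd Hx.
    apply (is_series_prim rho r f F M S T); auto.
    apply (normed_series _ _ f _ M S); auto.
Qed.

Lemma is_derive_prim (rho r : R) (f : R -> R -> R) (M d x : R) :
  normed rho r f M -> Rabs d < rho -> Rabs x < r ->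
  is_derive (prim f d) x (f d x).
Proof.
intros Hf Hd Hx; apply (is_derive_RInt (f d) (prim f d) 0 x).
- destruct (Rabs_lt_nbhd _ _ Hx) as [He Hn].
  exists (mkposreal _ He); intros y Hy.
  apply (RInt_correct (f d)), (normed_ex_RInt _ _ _ _ _ _ Hf Hd).
  replace y with (x + (y - x)) by ring; apply Hn; exact Hy.
- apply (normed_continuous_x _ _ _ _ _ _ Hf Hd Hx).
Qed.

Lemma prim_minus (rho r : R) (f g : R -> R -> R) (M M' d x : R) :
  normed rho r f M -> normed rho r g M' -> Rabs d < rho -> Rabs x < r ->
  prim (fun d x => f d x - g d x) d x = prim f d x - prim g d x.
Proof.
intros Hf Hg Hd Hx.
apply (RInt_minus (f d) (g d)).
- apply (normed_ex_RInt _ _ _ _ _ _ Hf); auto.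
- apply (normed_ex_RInt _ _ _ _ _ _ Hg); auto.
Qed.

Lemma prim_parity (rho r sgn : R) (f : R -> R -> R) (M d x : R) :
  normed rho r f M -> Rabs d < rho -> Rabs x < r ->
  (forall y, Rabs y < r -> f d (- y) = sgn * f d y) ->
  prim f d (- x) = - sgn * prim f d x.
Proof.
intros Hf Hd Hx Hs.
assert (H : is_RInt (f d) 0 (- x) (- sgn * prim f d x)).
{ assert (H1 : is_RInt (fun y => - f d (- y)) 0 x (scal (- sgn) (prim f d x))).
  { apply is_RInt_ext with (fun y => scal (- sgn) (f d y)).
    - intros y Hy; rewrite Hs; [unfold scal; simpl; unfold mult; simpl; ring|].
      apply (Rabs_between_0 x); [lra|auto].
    - apply (is_RInt_scal (f d)), (RInt_correct (f d)), (normed_ex_RInt _ _ _ _ _ _ Hf Hd Hx). }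
  replace 0 with (- 0) in H1 by ring.
  rewrite <- (Ropp_involutive x) in H1 at 1.
  apply (is_RInt_comp_opp (fun y => - f d (- y)) 0 (- x)) in H1.
  eapply is_RInt_ext; [|exact H1].
  intros y Hy; unfold opp; simpl; rewrite !Ropp_involutive; reflexivity. }
exact (is_RInt_unique _ _ _ _ H).
Qed.

(** * The linearized clamped problem *)

(** Exponential generating function: under a geometric bound on [c] it is entire, [c n] is its
    [n]-th derivative at 0, and differentiation shifts the sequence. *)
Definition egf (c : nat -> R) (x : R) : R := PSeries (fun n => c n / INR (Factorial.fact n)) x.

Lemma is_series_exp_majorant (A B : R) :
  is_series (fun n => A * B ^ n / INR (Factorial.fact n)) (A * exp B).
Proof.
apply is_series_ext with (fun n => A * (pow_n B n * / INR (Factorial.fact n))).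
- intros n; rewrite pow_n_pow; simpl; unfold Rdiv; ring.
- apply (is_series_scal_l A (fun n => pow_n B n * / INR (Factorial.fact n))), is_exp_Reals.
Qed.

Lemma egf_term_bound (c : nat -> R) (A B r x : R) (n : nat) :
  (forall n, Rabs (c n) <= A * B ^ n) -> Rabs x <= r ->
  Rabs (c n / INR (Factorial.fact n) * x ^ n) <= A * (B * r) ^ n / INR (Factorial.fact n).
Proof.
intros Hc Hx. assert (Hx0 := Rabs_pos x).
assert (Hf : 0 < / INR (Factorial.fact n)) by (apply Rinv_0_lt_compat, INR_fact_lt_0).
unfold Rdiv; rewrite !Rabs_mult, (Rabs_pos_eq (/ _)) by lra.
rewrite <- RPow_abs, Rpow_mult_distr.
replace (Rabs (c n) * / INR (Factorial.fact n) * Rabs x ^ n)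
  with (Rabs (c n) * Rabs x ^ n * / INR (Factorial.fact n)) by ring.
replace (A * (B ^ n * r ^ n)) with (A * B ^ n * r ^ n) by ring.
apply Rmult_le_compat_r; [lra|].
apply Rmult_le_compat; auto; try apply Rabs_pos.
- apply pow_le; auto.
- apply pow_incr; auto.
Qed.

Lemma is_series_egf (c : nat -> R) (A B x : R) :
  (forall n, Rabs (c n) <= A * B ^ n) ->
  is_series (fun n => c n / INR (Factorial.fact n) * x ^ n) (egf c x).
Proof.
intros Hc; apply Series_correct.
apply (ex_series_Rabs_le _ (fun n => A * (B * Rabs x) ^ n / INR (Factorial.fact n))).
- intros n; apply egf_term_bound; auto; lra.
- eexists; apply is_series_exp_majorant.
Qed.

Lemma normed_egf (rho r : R) (c : nat -> R) (A B : R) :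
  0 < r -> (forall n, Rabs (c n) <= A * B ^ n) ->
  normed rho r (fun _ x => egf c x) (A * exp (B * r)).
Proof.
intros Hr Hc.
apply (normed_series _ _ (fun n _ x => c n / INR (Factorial.fact n) * x ^ n) _
         (fun n => A * (B * r) ^ n / INR (Factorial.fact n)) (A * exp (B * r))).
- intros n; apply (normed_monomial _ _ _ (c n / INR (Factorial.fact n)) 0 n).
  + rewrite Rmult_1_r, <- (Rabs_pos_eq (r ^ n)), <- Rabs_mult by (apply pow_le; lra).
    apply egf_term_bound; auto; rewrite Rabs_pos_eq; lra.
  + intros d x _ _; simpl; ring.
- apply is_series_exp_majorant.
- lra.
- intros d x _ _; apply (is_series_egf _ A B); auto.
Qed.

Lemma is_derive_egf (c : nat -> R) (A B x : R) :
  (forall n, Rabs (c n) <= A * B ^ n) ->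
  is_derive (egf c) x (egf (fun n => c (S n)) x).
Proof.
intros Hc; unfold egf.
replace (PSeries (fun n => c (S n) / INR (Factorial.fact n)) x)
  with (PSeries (PS_derive (fun n => c n / INR (Factorial.fact n))) x).
(* A radius of convergence at most [Rabs x] would contradict convergence at [Rabs x + 1], where the
   terms tend to 0. *)
- apply is_derive_PSeries, Rbar_not_le_lt; intros Hle.
  apply (CV_disk_outside (fun n => c n / INR (Factorial.fact n)) (Rabs x + 1)).
  + eapply Rbar_le_lt_trans; [exact Hle|]; simpl.
    assert (H := Rabs_pos x); rewrite (Rabs_pos_eq (Rabs x + 1)); lra.
  + apply (ex_series_lim_0 (fun n => c n / INR (Factorial.fact n) * (Rabs x + 1) ^ n)).
    eexists; apply (is_series_egf _ A B); auto.
- apply PSeries_ext; intros n; unfold PS_derive.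
  rewrite fact_simpl, mult_INR.
  field; split; [apply INR_fact_neq_0|apply not_0_INR; lia].
Qed.

Lemma egf_0 (c : nat -> R) : egf c 0 = c 0%nat.
Proof. unfold egf; rewrite PSeries_0; simpl; field. Qed.

Lemma egf_parity (c : nat -> R) (sgn x : R) :
  (forall n, (-1) ^ n * c n = sgn * c n) -> egf c (- x) = sgn * egf c x.
Proof.
intros Hc; unfold egf, PSeries.
rewrite <- Series_scal_l; apply Series_ext; intros n.
replace (- x) with (-1 * x) by ring; rewrite Rpow_mult_distr.
replace (c n / INR (Factorial.fact n) * ((-1) ^ n * x ^ n))
  with ((-1) ^ n * c n * (x ^ n / INR (Factorial.fact n))) by (unfold Rdiv; ring).
rewrite Hc; unfold Rdiv; ring.
Qed.

(** Derivatives at 0 of the fundamental solution, read off from [y'''' = - kappa y]. Only indices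
    congruent to 3 modulo 4 survive, which fixes the parity of every [fund kappa j]. *)
Fixpoint fund_coef (kappa : R) (n : nat) : R :=
  match n with
  | 0 | 1 | 2 => 0
  | 3 => 1
  | S (S (S (S m))) => - kappa * fund_coef kappa m
  end.

(* The [j]-th derivative of the solution of [y'''' + kappa y = 0] with Cauchy
   data [(0, 0, 0, 1)] at [0]. *)
Definition fund (kappa : R) (j : nat) (x : R) : R := egf (fun n => fund_coef kappa (j + n)) x.

Lemma nat_ind4 (P : nat -> Prop) :
  P 0%nat -> P 1%nat -> P 2%nat -> P 3%nat -> (forall n, P n -> P (S (S (S (S n))))) ->
  forall n, P n.
Proof.
intros H0 H1 H2 H3 HS.
assert (H : forall n, P n /\ P (S n) /\ P (S (S n)) /\ P (S (S (S n)))).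
{ induction n as [|n IH]; intuition. }
intros n; apply H.
Qed.

Lemma fund_coef_bound (kappa : R) (n : nat) :
  0 < kappa -> Rabs (fund_coef kappa n) <= (1 + kappa) ^ n.
Proof.
intros Hk; induction n as [| | | |n IH] using nat_ind4.
1-4: simpl; rewrite ?Rabs_R0, ?Rabs_R1; nra.
change (fund_coef kappa (S (S (S (S n))))) with (- kappa * fund_coef kappa n).
rewrite Rabs_mult, Rabs_Ropp, (Rabs_pos_eq kappa) by lra.
change ((1 + kappa) ^ S (S (S (S n)))) with ((1 + kappa) ^ (4 + n)).
rewrite pow_add; apply Rmult_le_compat; auto; try lra; try apply Rabs_pos.
assert (H : 1 <= (1 + kappa) ^ 3) by (apply pow_R1_Rle; lra).
change ((1 + kappa) ^ 4) with ((1 + kappa) * (1 + kappa) ^ 3); nra.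
Qed.

Lemma fund_coef_shift_bound (kappa : R) (j n : nat) :
  0 < kappa -> Rabs (fund_coef kappa (j + n)) <= (1 + kappa) ^ j * (1 + kappa) ^ n.
Proof. intros Hk; rewrite <- pow_add; apply fund_coef_bound; auto. Qed.

Lemma fund_coef_parity (kappa : R) (n : nat) :
  (-1) ^ n * fund_coef kappa n = - fund_coef kappa n.
Proof.
induction n as [| | | |n IH] using nat_ind4; simpl; try ring.
simpl in IH.
replace (-1 * (-1 * (-1 * (-1 * (-1) ^ n))) * (- kappa * fund_coef kappa n))
  with (- kappa * ((-1) ^ n * fund_coef kappa n)) by ring.
rewrite IH; ring.
Qed.

Lemma is_derive_fund (kappa : R) (j : nat) (x : R) :
  0 < kappa -> is_derive (fund kappa j) x (fund kappa (S j) x).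
Proof.
intros Hk; unfold fund.
replace (egf (fun n => fund_coef kappa (S j + n)) x)
  with (egf (fun n => fund_coef kappa (j + S n)) x).
- apply (is_derive_egf (fun n => fund_coef kappa (j + n)) ((1 + kappa) ^ j) (1 + kappa)).
  intros n; apply fund_coef_shift_bound; auto.
- apply PSeries_ext; intros n; do 2 f_equal; lia.
Qed.

Lemma fund_4 (kappa : R) (j : nat) (x : R) : fund kappa (4 + j) x = - kappa * fund kappa j x.
Proof.
unfold fund, egf, PSeries; rewrite <- Series_scal_l; apply Series_ext; intros n.
change (fund_coef kappa (4 + j + n)) with (- kappa * fund_coef kappa (j + n)).
unfold Rdiv; ring.
Qed.

Lemma fund_0 (kappa : R) (j : nat) : fund kappa j 0 = fund_coef kappa j.
Proof. unfold fund; rewrite egf_0; f_equal; lia. Qed.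

Lemma fund_parity (kappa : R) (j : nat) (x : R) :
  fund kappa j (- x) = - (-1) ^ j * fund kappa j x.
Proof.
apply egf_parity; intros n.
assert (Hj : (-1) ^ j * (-1) ^ j = 1).
{ rewrite <- Rpow_mult_distr; replace (-1 * -1) with 1 by ring; apply pow1. }
assert (H := fund_coef_parity kappa (j + n)); rewrite pow_add in H.
apply (f_equal (Rmult ((-1) ^ j))) in H.
replace ((-1) ^ j * ((-1) ^ j * (-1) ^ n * fund_coef kappa (j + n)))
  with (((-1) ^ j * (-1) ^ j) * ((-1) ^ n * fund_coef kappa (j + n))) in H by ring.
rewrite Hj in H; rewrite Rmult_1_l in H; rewrite H; ring.
Qed.

Lemma normed_fund (rho r kappa : R) (j : nat) :
  0 < r -> 0 < kappa ->
  normed rho r (fun _ x => fund kappa j x) ((1 + kappa) ^ j * exp ((1 + kappa) * r)).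
Proof.
intros Hr Hk; apply normed_egf; auto.
intros n; apply fund_coef_shift_bound; auto.
Qed.

Lemma is_derive_zero_const (f : R -> R) :
  (forall x, is_derive f x 0) -> forall x, f x = f 0.
Proof.
intros Hf x; destruct (total_order_T x 0) as [[H| ->]|H]; auto.
- apply (eq_is_derive f); auto; intros t _; apply Hf.
- symmetry; apply (eq_is_derive f); auto; intros t _; apply Hf.
Qed.

Ltac derive_fund Hk :=
  auto_derive;
  [ repeat split; try (eexists; apply is_derive_fund; exact Hk)
  | repeat match goal with
    | |- context [Derive (fun x => fund ?k ?j x) ?y] =>
        replace (Derive (fun x => fund k j x) y) with (fund k (S j) y)
          by (symmetry; exact (is_derive_unique _ _ _ (is_derive_fund k j y Hk)))
    end;
    try rewrite (fund_4 _ 0) ].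

(** [2 y''' y' - y'' ^ 2 + kappa y ^ 2] is a first integral of [y'''' + kappa y = 0], zero for the
    data of [fund kappa 0]. It cancels the boundary term in the second derivative of the Duhamel
    integral. *)
Lemma fund_identity_0 (kappa : R) : 0 < kappa -> forall x,
  2 * fund kappa 3 x * fund kappa 1 x - fund kappa 2 x ^ 2 + kappa * fund kappa 0 x ^ 2 = 0.
Proof.
intros Hk x.
rewrite (is_derive_zero_const (fun x => 2 * fund kappa 3 x * fund kappa 1 x - fund kappa 2 x ^ 2
                                + kappa * fund kappa 0 x ^ 2)).
- rewrite !fund_0; simpl; ring.
- intros y; derive_fund Hk; ring.
Qed.

(** Up to a factor [kappa], the same first integral evaluated on [fund kappa 3], another solution of
    the equation. The value 1 is the coefficient with which [g] enters the fourth derivative of the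
    Duhamel integral. *)
Lemma fund_identity_1 (kappa : R) : 0 < kappa -> forall x,
  2 * kappa * fund kappa 2 x * fund kappa 0 x - kappa * fund kappa 1 x ^ 2 + fund kappa 3 x ^ 2 = 1.
Proof.
intros Hk x.
rewrite (is_derive_zero_const (fun x => 2 * kappa * fund kappa 2 x * fund kappa 0 x
           - kappa * fund kappa 1 x ^ 2 + fund kappa 3 x ^ 2)).
- rewrite !fund_0; simpl; ring.
- intros y; derive_fund Hk; ring.
Qed.

(** Determinant of the values and slopes at 1 of the even homogeneous solutions [fund kappa 3] and
    [fund kappa 1], with [fund kappa 4] rewritten as [- kappa * fund kappa 0]. *)
Definition clamp_det (kappa : R) : R :=
  fund kappa 3 1 * fund kappa 2 1 + kappa * fund kappa 0 1 * fund kappa 1 1.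

(** As a function of the endpoint, the determinant vanishes at 0 and has derivative [fund kappa 3 x
    ^ 2 + kappa * fund kappa 1 x ^ 2], which is nonnegative and equals 1 at 0. It is positive just
    to the right of 0 and cannot decrease afterwards. *)
Lemma clamp_det_pos (kappa : R) : 0 < kappa -> 0 < clamp_det kappa.
Proof.
intros Hk.
set (D := fun x => fund kappa 3 x * fund kappa 2 x + kappa * fund kappa 0 x * fund kappa 1 x).
assert (HD : forall x, is_derive D x (fund kappa 3 x ^ 2 + kappa * fund kappa 1 x ^ 2)).
{ intros x; unfold D; derive_fund Hk; ring. }
assert (HD0 : D 0 = 0) by (unfold D; rewrite !fund_0; simpl; ring).
assert (H0 := HD 0).
rewrite !fund_0 in H0; simpl in H0.
apply is_derive_Reals in H0.
(* The derivative at 0 is 1, so the quotient [D h / h] stays above 1/2 for [h] below [e]; bounding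
   [h] by 1/2 keeps it to the left of 1 for the mean value theorem. *)
destruct (H0 (/ 2)) as [e He]; [lra|].
set (h := Rmin (e / 2) (/ 2)).
assert (Hh : 0 < h) by (apply Rmin_pos; [assert (H := cond_pos e); lra|lra]).
assert (Hhe : h <= e / 2) by apply Rmin_l.
assert (Hh2 : h <= / 2) by apply Rmin_r.
assert (Hhp : 0 < D h).
{ assert (Hb : Rabs h < e) by (rewrite Rabs_pos_eq; assert (H := cond_pos e); lra).
  specialize (He h (Rgt_not_eq _ _ Hh) Hb).
  rewrite HD0, Rplus_0_l, Rminus_0_r in He.
  apply Rabs_def2 in He.
  assert (H1 : 0 < D h / h) by lra.
  replace (D h) with (D h / h * h) by (field; lra).
  apply Rmult_lt_0_compat; auto. }
apply Rlt_le_trans with (D h); auto.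
change (D h <= D 1).
destruct (MVT_gen D h 1 (fun x => fund kappa 3 x ^ 2 + kappa * fund kappa 1 x ^ 2))
  as [c [_ Hc]].
- intros x _; apply HD.
- intros x _; apply continuity_pt_filterlim, (ex_derive_continuous D); eexists; apply HD.
- assert (H1 := pow2_ge_0 (fund kappa 3 c)). assert (H2 := pow2_ge_0 (fund kappa 1 c)).
  assert (0 <= (fund kappa 3 c ^ 2 + kappa * fund kappa 1 c ^ 2) * (1 - h)).
  { apply Rmult_le_pos; [apply Rplus_le_le_0_compat; [|apply Rmult_le_pos]|]; lra. }
  lra.
Qed.

(** * Bounded operators and the clamped solution operator *)

(** The constant [C] is uniform in [rho], because [rho] is fixed only after the contraction
    constants are known. Of linearity only compatibility with differences is kept, pointwise on the
    disc. *)
Definition bounded_op (r : R) (T : (R -> R -> R) -> R -> R -> R) : Prop :=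
  (exists C, 0 <= C /\ forall rho g M, 0 < rho -> normed rho r g M -> normed rho r (T g) (C * M)) /\
  (forall rho g h M M' d x, normed rho r g M -> normed rho r h M' ->
     Rabs d < rho -> Rabs x < r ->
     T (fun d x => g d x - h d x) d x = T g d x - T h d x).

Lemma bounded_op_id (r : R) : bounded_op r (fun g => g).
Proof.
split; [|reflexivity].
exists 1; split; [lra|]; intros rho g M _ Hg; rewrite Rmult_1_l; auto.
Qed.

Lemma bounded_op_plus (r : R) (T U : (R -> R -> R) -> R -> R -> R) :
  bounded_op r T -> bounded_op r U -> bounded_op r (fun g d x => T g d x + U g d x).
Proof.
intros [[C [HC HT]] HT'] [[C' [HC' HU]] HU']; split.
- exists (C + C'); split; [lra|]; intros rho g M Hrho Hg.
  rewrite Rmult_plus_distr_r; apply normed_plus; auto.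
- intros rho g h M M' d x Hg Hh Hd Hx.
  rewrite (HT' rho g h M M'), (HU' rho g h M M') by auto; ring.
Qed.

Lemma bounded_op_mult (r : R) (a : R -> R) (A : R) (T : (R -> R -> R) -> R -> R -> R) :
  0 < r -> (forall rho, normed rho r (fun _ x => a x) A) ->
  bounded_op r T -> bounded_op r (fun g d x => a x * T g d x).
Proof.
intros Hr Ha [[C [HC HT]] HT']; split.
- exists (A * C); split.
  + apply Rmult_le_pos; auto; apply (normed_pos 1 r _ _ Rlt_0_1 Hr (Ha 1)).
  + intros rho g M Hrho Hg; rewrite Rmult_assoc; apply (normed_mult _ _ (fun _ x => a x)); auto.
- intros rho g h M M' d x Hg Hh Hd Hx.
  rewrite (HT' rho g h M M') by auto; ring.
Qed.

Lemma bounded_op_scal (r a : R) (T : (R -> R -> R) -> R -> R -> R) :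
  0 < r -> bounded_op r T -> bounded_op r (fun g d x => a * T g d x).
Proof.
intros Hr; apply (bounded_op_mult r (fun _ => a) (Rabs a)); auto.
intros rho; apply normed_const.
Qed.

Lemma bounded_op_eval (r x0 : R) (T : (R -> R -> R) -> R -> R -> R) :
  Rabs x0 < r -> bounded_op r T -> bounded_op r (fun g d _ => T g d x0).
Proof.
intros Hx0 [[C [HC HT]] HT']; split.
- exists C; split; auto; intros rho g M Hrho Hg; apply (normed_eval rho r x0 (T g)); auto.
- intros rho g h M M' d x Hg Hh Hd Hx; apply (HT' rho g h M M'); auto.
Qed.

Lemma bounded_op_prim (r : R) (a : R -> R) (A : R) :
  0 < r -> (forall rho, normed rho r (fun _ x => a x) A) ->
  bounded_op r (fun g => prim (fun d y => a y * g d y)).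
Proof.
intros Hr Ha; split.
- exists (r * A); split.
  + apply Rmult_le_pos; [lra|]; apply (normed_pos 1 r _ _ Rlt_0_1 Hr (Ha 1)).
  + intros rho g M Hrho Hg; rewrite Rmult_assoc; apply normed_prim; auto.
    apply (normed_mult _ _ (fun _ x => a x)); auto.
- intros rho g h M M' d x Hg Hh Hd Hx.
  assert (Hrho : 0 < rho) by (assert (H := Rabs_pos d); lra).
  rewrite <- (prim_minus rho r _ _ (A * M) (A * M')); auto.
  + apply RInt_ext; intros y _; apply Rmult_minus_distr_l.
  + apply (normed_mult _ _ (fun _ x => a x)); auto.
  + apply (normed_mult _ _ (fun _ x => a x)); auto.
Qed.

Definition moment (kappa : R) (j : nat) (g : R -> R -> R) : R -> R -> R :=
  prim (fun d y => fund kappa j y * g d y).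

(* Variation of parameters: the expansion of [int_0^x k (x - y) g (y) dy], with
   [k = fund kappa 0], and of its first derivatives in the moments of [g]. *)
Definition duhamel (kappa : R) (i : nat) (g : R -> R -> R) (d x : R) : R :=
  -1 * (fund kappa (3 + i) x * moment kappa 0 g d x)
  + fund kappa (2 + i) x * moment kappa 1 g d x
  + -1 * (fund kappa (1 + i) x * moment kappa 2 g d x)
  + fund kappa i x * moment kappa 3 g d x.

(* For even [g], the [i]-th derivative ([i <= 3]) of the even solution of
   [v'''' + kappa v = g], [v = v' = 0] at [1]; the even homogeneous solutions
   are spanned by [fund kappa 3] and [fund kappa 1]. *)
Definition clamped (kappa : R) (i : nat) (g : R -> R -> R) (d x : R) : R :=
  duhamel kappa i g d x
  + fund kappa (3 + i) x *
      ((- fund kappa 2 1 / clamp_det kappa) * duhamel kappa 0 g d 1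
       + fund kappa 1 1 / clamp_det kappa * duhamel kappa 1 g d 1)
  + fund kappa (1 + i) x *
      ((- fund kappa 3 1 / clamp_det kappa) * duhamel kappa 1 g d 1
       + (- kappa * fund kappa 0 1 / clamp_det kappa) * duhamel kappa 0 g d 1).

Lemma bounded_op_fund (r kappa : R) (j : nat) (T : (R -> R -> R) -> R -> R -> R) :
  0 < r -> 0 < kappa -> bounded_op r T -> bounded_op r (fun g d x => fund kappa j x * T g d x).
Proof.
intros Hr Hk; apply (bounded_op_mult r (fund kappa j) ((1 + kappa) ^ j * exp ((1 + kappa) * r))); auto.
intros rho; apply normed_fund; auto.
Qed.

Lemma bounded_op_moment (r kappa : R) (j : nat) :
  0 < r -> 0 < kappa -> bounded_op r (moment kappa j).
Proof.
intros Hr Hk; apply (bounded_op_prim r (fund kappa j) ((1 + kappa) ^ j * exp ((1 + kappa) * r))); auto.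
intros rho; apply normed_fund; auto.
Qed.

Lemma bounded_op_duhamel (r kappa : R) (i : nat) :
  0 < r -> 0 < kappa -> bounded_op r (duhamel kappa i).
Proof.
intros Hr Hk; unfold duhamel.
repeat apply bounded_op_plus; try apply bounded_op_scal; auto;
  apply bounded_op_fund; auto; apply bounded_op_moment; auto.
Qed.

Lemma bounded_op_clamped (r kappa : R) (i : nat) :
  1 < r -> 0 < kappa -> bounded_op r (clamped kappa i).
Proof.
intros Hr Hk; unfold clamped.
assert (H1 : Rabs 1 < r) by (rewrite Rabs_R1; auto).
assert (Hd := fun j => bounded_op_duhamel r kappa j (Rlt_trans _ _ _ Rlt_0_1 Hr) Hk).
assert (H0 : 0 < r) by lra.
apply bounded_op_plus; [apply bounded_op_plus; [apply Hd|]|];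
  (apply bounded_op_fund; [exact H0|exact Hk|]);
  (apply bounded_op_plus; apply bounded_op_scal, bounded_op_eval; auto).
Qed.

Lemma is_derive_moment (rho r kappa : R) (j : nat) (g : R -> R -> R) (M d x : R) :
  0 < kappa -> normed rho r g M -> Rabs d < rho -> Rabs x < r ->
  is_derive (moment kappa j g d) x (fund kappa j x * g d x).
Proof.
intros Hk Hg Hd Hx.
assert (0 < rho) by (assert (H := Rabs_pos d); lra).
assert (0 < r) by (assert (H1 := Rabs_pos x); lra).
apply (is_derive_prim rho r (fun d y => fund kappa j y * g d y)
         ((1 + kappa) ^ j * exp ((1 + kappa) * r) * M)); auto.
apply (normed_mult _ _ (fun _ y => fund kappa j y)); auto.
apply normed_fund; auto.
Qed.

(** The factor of [g d x] is the boundary term of the Duhamel integral: the expansion of the [i]-th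
    derivative of [k (x - y)] at [y = x], that is, of the [i]-th derivative of [k] at 0. It is left
    unevaluated here; the two first integrals later give 0 for [i < 3] and 1 for [i = 3]. *)
Lemma is_derive_duhamel (rho r kappa : R) (i : nat) (g : R -> R -> R) (M d x : R) :
  0 < kappa -> normed rho r g M -> Rabs d < rho -> Rabs x < r ->
  is_derive (duhamel kappa i g d) x
    (duhamel kappa (S i) g d x
     + (- (fund kappa (3 + i) x * fund kappa 0 x) + fund kappa (2 + i) x * fund kappa 1 x
        - fund kappa (1 + i) x * fund kappa 2 x + fund kappa i x * fund kappa 3 x) * g d x).
Proof.
intros Hk Hg Hd Hx; unfold duhamel.
assert (Hm := fun j => is_derive_moment rho r kappa j g M d x Hk Hg Hd Hx).
assert (Hf := fun j => is_derive_fund kappa j x Hk).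
auto_derive.
- repeat split;
  lazymatch goal with
  | |- ex_derive (fun _ => moment _ ?j _ _ _) _ => eexists; exact (Hm j)
  | |- ex_derive (fun _ => fund _ ?j _) _ => eexists; exact (Hf j)
  end.
- repeat match goal with
  | |- context [Derive (fun y => fund kappa ?j y) x] =>
      replace (Derive (fun y => fund kappa j y) x) with (fund kappa (S j) x)
        by (symmetry; exact (is_derive_unique _ _ _ (Hf j)))
  | |- context [Derive (fun y => moment kappa ?j g d y) x] =>
      replace (Derive (fun y => moment kappa j g d y) x) with (fund kappa j x * g d x)
        by (symmetry; exact (is_derive_unique _ _ _ (Hm j)))
  end.
  simpl; ring.
Qed.

Lemma is_derive_clamped (rho r kappa : R) (i : nat) (g : R -> R -> R) (M d x : R) :
  0 < kappa -> normed rho r g M -> Rabs d < rho -> Rabs x < r -> (i < 3)%nat ->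
  is_derive (clamped kappa i g d) x (clamped kappa (S i) g d x).
Proof.
intros Hk Hg Hd Hx Hi; unfold clamped.
assert (Hf := fun j => is_derive_fund kappa j x Hk).
assert (Hu : is_derive (duhamel kappa i g d) x (duhamel kappa (S i) g d x)).
{ assert (H := is_derive_duhamel rho r kappa i g M d x Hk Hg Hd Hx).
  (* Only [i = 1] needs the first integral; for [i = 0] and [i = 2] the terms cancel in pairs. *)
  match type of H with is_derive _ _ (_ + ?c * _) => assert (Hc : c = 0) end.
  - assert (H0 := fund_identity_0 kappa Hk x).
    destruct i as [|[|[|i]]]; [| | |lia]; simpl; rewrite ?(fund_4 _ 0), ?(fund_4 _ 1); lra.
  - rewrite Hc, Rmult_0_l, Rplus_0_r in H; exact H. }
auto_derive.
- repeat split;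
  lazymatch goal with
  | |- ex_derive (fun _ => duhamel _ _ _ _ _) _ => eexists; exact Hu
  | |- ex_derive (fun _ => fund _ ?j _) _ => eexists; exact (Hf j)
  end.
- repeat match goal with
  | |- context [Derive (fun y => fund kappa ?j y) x] =>
      replace (Derive (fun y => fund kappa j y) x) with (fund kappa (S j) x)
        by (symmetry; exact (is_derive_unique _ _ _ (Hf j)))
  | |- context [Derive (fun y => duhamel kappa ?j g d y) x] =>
      replace (Derive (fun y => duhamel kappa j g d y) x) with (duhamel kappa (S j) g d x)
        by (symmetry; exact (is_derive_unique _ _ _ Hu))
  end.
  simpl; ring.
Qed.

(** Index 4 is a formal extension: the true fourth derivative also contains [g]. It lets the last
    differentiation be written as [clamped kappa 4 g] plus [g]. *)
Lemma clamped_4 (kappa : R) (g : R -> R -> R) (d x : R) :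
  clamped kappa 4 g d x = - kappa * clamped kappa 0 g d x.
Proof.
unfold clamped, duhamel.
change (fund kappa (3 + 4) x) with (fund kappa (4 + 3) x).
change (fund kappa (2 + 4) x) with (fund kappa (4 + 2) x).
change (fund kappa (1 + 4) x) with (fund kappa (4 + 1) x).
change (fund kappa 4 x) with (fund kappa (4 + 0) x).
rewrite !fund_4; simpl; ring.
Qed.

Lemma is_derive_clamped_3 (rho r kappa : R) (g : R -> R -> R) (M d x : R) :
  0 < kappa -> normed rho r g M -> Rabs d < rho -> Rabs x < r ->
  is_derive (clamped kappa 3 g d) x (g d x - kappa * clamped kappa 0 g d x).
Proof.
intros Hk Hg Hd Hx.
replace (g d x - kappa * clamped kappa 0 g d x) with (g d x + clamped kappa 4 g d x)
  by (rewrite clamped_4; ring).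
unfold clamped.
assert (Hf := fun j => is_derive_fund kappa j x Hk).
assert (Hu : is_derive (duhamel kappa 3 g d) x (duhamel kappa 4 g d x + g d x)).
{ assert (H := is_derive_duhamel rho r kappa 3 g M d x Hk Hg Hd Hx).
  match type of H with is_derive _ _ (_ + ?c * _) => assert (Hc : c = 1) end.
  - assert (H0 := fund_identity_1 kappa Hk x).
    change (3 + 3)%nat with (4 + 2)%nat; change (2 + 3)%nat with (4 + 1)%nat;
    change (1 + 3)%nat with (4 + 0)%nat.
    rewrite !fund_4; lra.
  - rewrite Hc, Rmult_1_l in H; exact H. }
auto_derive.
- repeat split;
  lazymatch goal with
  | |- ex_derive (fun _ => duhamel _ _ _ _ _) _ => eexists; exact Hu
  | |- ex_derive (fun _ => fund _ ?j _) _ => eexists; exact (Hf j)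
  end.
- repeat match goal with
  | |- context [Derive (fun y => fund kappa ?j y) x] =>
      replace (Derive (fun y => fund kappa j y) x) with (fund kappa (S j) x)
        by (symmetry; exact (is_derive_unique _ _ _ (Hf j)))
  | |- context [Derive (fun y => duhamel kappa ?j g d y) x] =>
      replace (Derive (fun y => duhamel kappa j g d y) x) with (duhamel kappa 4 g d x + g d x)
        by (symmetry; exact (is_derive_unique _ _ _ Hu))
  end.
  simpl; ring.
Qed.

(** The coefficients of [fund kappa (3 + i)] and [fund kappa (1 + i)] in [clamped] are Cramer's rule
    for cancelling the value and slope of the Duhamel integral at 1. *)
Lemma clamped_boundary (kappa : R) (i : nat) (g : R -> R -> R) (d : R) :
  0 < kappa -> (i < 2)%nat -> clamped kappa i g d 1 = 0.
Proof.
intros Hk Hi. assert (H := clamp_det_pos kappa Hk).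
destruct i as [|[|i]]; [| |lia]; unfold clamped; simpl Nat.add; rewrite ?(fund_4 _ 0).
all: unfold clamp_det in *; field; lra.
Qed.

(** The [j]-th moment of an even [g] has parity [(-1) ^ j] and [fund kappa j] the opposite one, so
    every term of [clamped kappa i] has parity [(-1) ^ i]. This yields the conditions at [-1] from
    those at [1]. *)
Lemma clamped_parity (rho r kappa : R) (i : nat) (g : R -> R -> R) (M d x : R) :
  0 < kappa -> normed rho r g M -> Rabs d < rho -> Rabs x < r ->
  (forall y, Rabs y < r -> g d (- y) = g d y) ->
  clamped kappa i g d (- x) = (-1) ^ i * clamped kappa i g d x.
Proof.
intros Hk Hg Hd Hx Heven.
assert (0 < rho) by (assert (H := Rabs_pos d); lra).
assert (0 < r) by (assert (H1 := Rabs_pos x); lra).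
assert (Hm : forall j, moment kappa j g d (- x) = - (- (-1) ^ j) * moment kappa j g d x).
{ intros j; apply (prim_parity rho r _ _ ((1 + kappa) ^ j * exp ((1 + kappa) * r) * M)); auto.
  - apply (normed_mult _ _ (fun _ y => fund kappa j y)); auto.
    apply normed_fund; auto.
  - intros y Hy; rewrite fund_parity, Heven by auto; ring. }
assert (Hu : duhamel kappa i g d (- x) = (-1) ^ i * duhamel kappa i g d x).
{ unfold duhamel; rewrite !Hm, !fund_parity, !pow_add; simpl; ring. }
unfold clamped; rewrite Hu, !fund_parity, !pow_add; simpl; ring.
Qed.

(** * The nonlinear fixed point *)

Definition even_on (rho r : R) (g : R -> R -> R) : Prop :=
  forall d x, Rabs d < rho -> Rabs x < r -> g d (- x) = g d x.

Lemma geom_bound_0 (b y : R) : (forall n, Rabs y <= b * (/ 2) ^ n) -> y = 0.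
Proof.
intros H.
assert (H0 : Rabs y <= 0).
{ apply (is_lim_seq_le (fun _ => Rabs y) (fun n => b * (/ 2) ^ n) (Rabs y) 0); auto.
  - apply is_lim_seq_const.
  - replace (Finite 0) with (Rbar_mult b 0) by (simpl; f_equal; ring).
    apply is_lim_seq_scal_l, is_lim_seq_geom.
    rewrite Rabs_pos_eq; lra. }
assert (H1 := Rabs_pos y).
destruct (Req_dec y 0) as [|Hy]; auto.
apply Rabs_pos_lt in Hy; lra.
Qed.

Lemma is_series_half_geom (b : R) (n : nat) :
  is_series (fun k => b / 2 * (/ 2) ^ (k + n)) (b * (/ 2) ^ n).
Proof.
replace (b * (/ 2) ^ n) with (b / 2 * (/ 2) ^ n * / (1 - / 2)) by field.
apply is_series_ext with (fun k => b / 2 * (/ 2) ^ n * (/ 2) ^ k).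
- intros k; rewrite pow_add; simpl; ring.
- apply (is_series_scal_l (b / 2 * (/ 2) ^ n) (fun k => (/ 2) ^ k)).
  apply is_series_geom; rewrite Rabs_pos_eq; lra.
Qed.

(** Picard iteration from 0. No complete space is set up: the limit is the sum of the increments,
    and [normed_series] bounds such a sum directly. Mapping into radius [b / 2] makes the increments
    sum to at most [b]. *)
Lemma normed_fixpoint (rho r b : R) (Phi : (R -> R -> R) -> R -> R -> R) :
  0 < rho -> 0 < r -> 0 < b ->
  (forall g, normed rho r g b -> even_on rho r g ->
     normed rho r (Phi g) (b / 2) /\ even_on rho r (Phi g)) ->
  (forall g h D, 0 <= D -> normed rho r g b -> normed rho r h b ->
     normed rho r (fun d x => g d x - h d x) D ->
     normed rho r (fun d x => Phi g d x - Phi h d x) (D / 2)) ->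
  exists g, normed rho r g b /\ even_on rho r g /\
    forall d x, Rabs d < rho -> Rabs x < r -> g d x = Phi g d x.
Proof.
intros Hrho Hr Hb Hself Hcontr.
set (it := fix it n := match n with 0%nat => fun _ _ : R => 0 | S n => Phi (it n) end).
assert (Hit : forall n, normed rho r (it n) b /\ even_on rho r (it n)).
{ induction n as [|n [IH1 IH2]].
  - split; [apply normed_zero; lra|intros d x _ _; reflexivity].
  - destruct (Hself _ IH1 IH2) as [H1 H2]; split; auto.
    apply normed_le with (b / 2); [lra|exact H1]. }
assert (Hstep : forall n, normed rho r (fun d x => it (S n) d x - it n d x) (b / 2 * (/ 2) ^ n)).
{ induction n as [|n IH].
  - destruct (Hself _ (proj1 (Hit 0%nat)) (proj2 (Hit 0%nat))) as [H _].
    apply normed_le with (b / 2); [simpl; lra|].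
    apply (normed_ext _ _ (it 1%nat)); [intros; simpl; ring|exact H].
  - apply normed_le with (b / 2 * (/ 2) ^ n / 2); [simpl; lra|].
    apply (Hcontr (it (S n)) (it n)); try apply Hit; auto.
    apply Rmult_le_pos; [lra|apply pow_le; lra]. }
set (g := fun d x => Series (fun k => it (S k) d x - it k d x)).
(* The increments from rank [n] on telescope to [g - it n], which measures the distance of [g] to
   every iterate. *)
assert (Hser : forall n d x, Rabs d < rho -> Rabs x < r ->
  is_series (fun k => it (S (k + n)) d x - it (k + n)%nat d x) (g d x - it n d x)).
{ intros n d x Hd Hx; induction n as [|n IH].
  - replace (g d x - it 0%nat d x) with (g d x) by (simpl; ring).
    apply is_series_ext with (fun k => it (S k) d x - it k d x).
    { intros k; rewrite Nat.add_0_r; reflexivity. }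
    apply Series_correct, (ex_series_Rabs_le _ (fun k => b / 2 * (/ 2) ^ (k + 0))).
    + intros k; rewrite Nat.add_0_r; apply (normed_bound _ _ _ _ (Hstep k)); auto.
    + eexists; apply is_series_half_geom.
  - eapply is_series_ext;
      [|apply (is_series_incr_1 (fun k => it (S (k + n)) d x - it (k + n)%nat d x)
                 (g d x - it (S n) d x))].
    + intros k; cbv beta; replace (k + S n)%nat with (S k + n)%nat by lia; reflexivity.
    + match goal with |- is_series _ ?l => replace l with (g d x - it n d x) end; auto.
      unfold plus; simpl; ring. }
assert (Hdist : forall n, normed rho r (fun d x => g d x - it n d x) (b * (/ 2) ^ n)).
{ intros n; apply (normed_series _ _ (fun k d x => it (S (k + n)) d x - it (k + n)%nat d x) _
                     (fun k => b / 2 * (/ 2) ^ (k + n)) (b * (/ 2) ^ n)); auto; [apply is_series_half_geom|lra]. }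
assert (Hg : normed rho r g b).
{ apply (normed_ext _ _ (fun d x => g d x - it 0%nat d x)); [intros; simpl; ring|].
  apply normed_le with (b * (/ 2) ^ 0); [simpl; lra|apply Hdist]. }
exists g; split; [exact Hg|split].
- intros d x Hd Hx; apply Series_ext; intros k.
  rewrite (proj2 (Hit (S k)) d x), (proj2 (Hit k) d x) by auto; reflexivity.
(* [g] and [Phi g] are each within [b * (/ 2) ^ S n] of [it (S n) = Phi (it n)], so they differ by
   at most [b * (/ 2) ^ n] for every [n]. *)
- intros d x Hd Hx; apply Rminus_diag_uniq, (geom_bound_0 b); intros n.
  replace (g d x - Phi g d x) with ((g d x - it (S n) d x) - (Phi g d x - Phi (it n) d x))
    by (simpl; ring).
  assert (H1 := normed_bound _ _ _ _ (Hdist (S n)) d x Hd Hx).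
  assert (Hn : 0 <= b * (/ 2) ^ n) by (apply Rmult_le_pos; [lra|apply pow_le; lra]).
  assert (H2 := normed_bound _ _ _ _
    (Hcontr g (it n) _ Hn Hg (proj1 (Hit n)) (Hdist n)) d x Hd Hx).
  unfold Rminus at 1; eapply Rle_trans; [apply Rabs_triang|].
  rewrite Rabs_Ropp; cbv beta in H1, H2; simpl pow in H1; lra.
Qed.

(** * Weighted order of vanishing *)

Definition along (f : R -> (nat -> R) -> R) (Y : nat -> R -> R -> R) (d x : R) : R :=
  f d (fun i => Y i d x).

(* [f] vanishes to order [k] at the origin when each component of the state has
   weight [1] and the parameter [d] has weight [2]. *)
Definition vanishing (r : R) (k : nat) (f : R -> (nat -> R) -> R) : Prop :=
  exists C, 0 <= C /\ forall eta rho D (Y Y' : nat -> R -> R -> R),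
    0 < eta <= 1 -> 0 < rho <= eta ^ 2 -> 0 <= D ->
    (forall i, normed rho r (Y i) eta) -> (forall i, normed rho r (Y' i) eta) ->
    (forall i, normed rho r (fun d x => Y i d x - Y' i d x) D) ->
    normed rho r (along f Y) (C * eta ^ k) /\
    normed rho r (fun d x => along f Y d x - along f Y' d x) (C * eta ^ pred k * D).

Lemma vanishing_ext (r : R) (k : nat) (f g : R -> (nat -> R) -> R) :
  (forall d y, f d y = g d y) -> vanishing r k f -> vanishing r k g.
Proof.
intros Hfg [C [HC H]]; exists C; split; auto.
intros eta rho D Y Y' He Hrho HD HY HY' HYD.
destruct (H eta rho D Y Y' He Hrho HD HY HY' HYD) as [H1 H2]; split.
- eapply normed_ext; [|exact H1]; intros; apply Hfg.
- eapply normed_ext; [|exact H2]; intros; unfold along; rewrite !Hfg; reflexivity.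
Qed.

Lemma pow_decr_exponent (eta : R) (m n : nat) : 0 < eta <= 1 -> (m <= n)%nat -> eta ^ n <= eta ^ m.
Proof.
intros He Hmn; replace n with (m + (n - m))%nat by lia; rewrite pow_add.
rewrite <- (Rmult_1_r (eta ^ m)) at 2.
apply Rmult_le_compat_l; [apply pow_le; lra|].
rewrite <- (pow1 (n - m)); apply pow_incr; lra.
Qed.

Lemma vanishing_weaken (r : R) (j k : nat) (f : R -> (nat -> R) -> R) :
  (j <= k)%nat -> vanishing r k f -> vanishing r j f.
Proof.
intros Hjk [C [HC H]]; exists C; split; auto.
intros eta rho D Y Y' He Hrho HD HY HY' HYD.
destruct (H eta rho D Y Y' He Hrho HD HY HY' HYD) as [H1 H2]; split.
- apply normed_le with (C * eta ^ k); auto.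
  apply Rmult_le_compat_l; auto; apply pow_decr_exponent; auto.
- apply normed_le with (C * eta ^ pred k * D); auto.
  apply Rmult_le_compat_r; auto; apply Rmult_le_compat_l; auto.
  apply pow_decr_exponent; auto; lia.
Qed.

Lemma vanishing_const (r c : R) : vanishing r 0 (fun _ _ => c).
Proof.
exists (Rabs c); split; [apply Rabs_pos|].
intros eta rho D Y Y' He Hrho HD HY HY' HYD; split.
- rewrite Rmult_1_r; apply (normed_const rho r c).
- apply (normed_ext _ _ (fun _ _ => 0)); [intros; unfold along; ring|].
  apply normed_zero, Rmult_le_pos; auto.
  rewrite Rmult_1_r; apply Rabs_pos.
Qed.

Lemma vanishing_param (r : R) : vanishing r 2 (fun d _ => d).
Proof.
exists 1; split; [lra|].
intros eta rho D Y Y' He Hrho HD HY HY' HYD; split.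
- apply (normed_monomial _ _ _ 1 1 0); [rewrite Rabs_R1; simpl in *; lra|].
  intros; unfold along; simpl; ring.
- apply (normed_ext _ _ (fun _ _ => 0)); [intros; unfold along; ring|].
  apply normed_zero; simpl; nra.
Qed.

Lemma vanishing_var (r : R) (i : nat) : vanishing r 1 (fun _ y => y i).
Proof.
exists 1; split; [lra|].
intros eta rho D Y Y' He Hrho HD HY HY' HYD; split.
- apply normed_le with eta; [simpl; lra|apply HY].
- apply normed_le with D; [simpl; lra|apply HYD].
Qed.

Lemma vanishing_plus (r : R) (k : nat) (f g : R -> (nat -> R) -> R) :
  vanishing r k f -> vanishing r k g -> vanishing r k (fun d y => f d y + g d y).
Proof.
intros [C [HC Hf]] [C' [HC' Hg]]; exists (C + C'); split; [lra|].
intros eta rho D Y Y' He Hrho HD HY HY' HYD.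
destruct (Hf eta rho D Y Y' He Hrho HD HY HY' HYD) as [Hf1 Hf2].
destruct (Hg eta rho D Y Y' He Hrho HD HY HY' HYD) as [Hg1 Hg2]; split.
- rewrite Rmult_plus_distr_r; apply (normed_plus _ _ (along f Y) (along g Y)); auto.
- replace ((C + C') * eta ^ pred k * D) with (C * eta ^ pred k * D + C' * eta ^ pred k * D) by ring.
  eapply normed_ext; [|apply (normed_plus _ _ _ _ _ _ Hf2 Hg2)].
  intros; unfold along; ring.
Qed.

(** The factor 2 collects the two terms of the product rule for differences. Their exponents
    [pred j + k] and [j + pred k] are at least [pred (j + k)], even where [pred] truncates at 0, and
    [eta <= 1] absorbs the excess. *)
Lemma vanishing_mult (r : R) (j k : nat) (f g : R -> (nat -> R) -> R) :
  0 < r -> vanishing r j f -> vanishing r k g -> vanishing r (j + k) (fun d y => f d y * g d y).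
Proof.
intros Hr [C [HC Hf]] [C' [HC' Hg]]; exists (2 * (C * C')).
assert (HCC : 0 <= C * C') by (apply Rmult_le_pos; auto).
split; [lra|].
intros eta rho D Y Y' He Hrho HD HY HY' HYD.
destruct (Hf eta rho D Y Y' He Hrho HD HY HY' HYD) as [Hf1 Hf2].
destruct (Hg eta rho D Y Y' He Hrho HD HY HY' HYD) as [Hg1 Hg2].
(* The size bound in [vanishing] concerns only the first of the two states; pairing [Y'] with itself
   gives it for [along f Y']. *)
assert (HY0 : forall i, normed rho r (fun d x => Y' i d x - Y' i d x) 0).
{ intros i; apply (normed_ext _ _ (fun _ _ => 0)); [intros; ring|apply normed_zero; lra]. }
destruct (Hf eta rho 0 Y' Y' He Hrho (Rle_refl 0) HY' HY' HY0) as [Hf1' _].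
assert (Hp : forall m, 0 <= eta ^ m) by (intros m; apply pow_le; lra).
split.
- apply normed_le with (C * eta ^ j * (C' * eta ^ k)).
  + rewrite pow_add; assert (H := Rmult_le_pos _ _ HCC (Rmult_le_pos _ _ (Hp j) (Hp k))); lra.
  + apply (normed_mult _ _ (along f Y) (along g Y)); auto; lra.
- apply normed_le with (C * eta ^ pred j * D * (C' * eta ^ k)
                        + C * eta ^ j * (C' * eta ^ pred k * D)).
  + replace (C * eta ^ pred j * D * (C' * eta ^ k) + C * eta ^ j * (C' * eta ^ pred k * D))
      with (C * C' * (eta ^ (pred j + k) + eta ^ (j + pred k)) * D) by (rewrite !pow_add; ring).
    apply Rmult_le_compat_r; auto.
    replace (2 * (C * C') * eta ^ pred (j + k))
      with (C * C' * (eta ^ pred (j + k) + eta ^ pred (j + k))) by ring.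
    apply Rmult_le_compat_l; auto.
    apply Rplus_le_compat; apply pow_decr_exponent; auto; lia.
  + apply (normed_ext _ _ (fun d x => (along f Y d x - along f Y' d x) * along g Y d x
             + along f Y' d x * (along g Y d x - along g Y' d x))).
    { intros; unfold along; ring. }
    apply normed_plus; apply (normed_mult _ _ _ _ _ _); auto; lra.
Qed.

Definition linear_form (l y : nat -> R) : R :=
  l 0%nat * y 0%nat + l 1%nat * y 1%nat + l 2%nat * y 2%nat + l 3%nat * y 3%nat + l 4%nat * y 4%nat.

Lemma vanishing_scal (r a : R) (k : nat) (f : R -> (nat -> R) -> R) :
  0 < r -> vanishing r k f -> vanishing r k (fun d y => a * f d y).
Proof. intros Hr Hf; apply (vanishing_mult r 0 k (fun _ _ => a)); auto; apply vanishing_const. Qed.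

Lemma vanishing_linear_form (r : R) (l : nat -> R) :
  0 < r -> vanishing r 1 (fun _ y => linear_form l y).
Proof.
intros Hr; unfold linear_form.
repeat apply vanishing_plus; apply vanishing_scal; auto; apply vanishing_var.
Qed.

(** First-order Taylor expansion at the origin with remainder of weighted order 2. The parameter has
    no linear coefficient because its weight already puts it in the remainder. *)
Definition jet (r : R) (f : R -> (nat -> R) -> R) (c : R) (l : nat -> R) : Prop :=
  vanishing r 2 (fun d y => f d y - (c + linear_form l y)).

Lemma jet_const (r c : R) : jet r (fun _ _ => c) c (fun _ => 0).
Proof.
apply vanishing_ext with (fun _ _ => 0); [intros; unfold linear_form; ring|].
exists 0; split; [lra|]; intros; split;
  (apply (normed_ext _ _ (fun _ _ => 0)); [intros; unfold along; ring|apply normed_zero; lra]).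
Qed.

Lemma jet_param (r : R) : jet r (fun d _ => d) 0 (fun _ => 0).
Proof.
apply vanishing_ext with (fun d _ => d); [intros; unfold linear_form; ring|apply vanishing_param].
Qed.

Lemma jet_var (r : R) (i : nat) :
  (i < 5)%nat -> jet r (fun _ y => y i) 0 (fun j => if Nat.eqb j i then 1 else 0).
Proof.
intros Hi; eapply vanishing_ext; [|exact (jet_const r 0)].
intros d y; unfold linear_form.
destruct i as [|[|[|[|[|i]]]]]; simpl; try ring; lia.
Qed.

Lemma jet_plus (r : R) (f g : R -> (nat -> R) -> R) (c c' : R) (l l' : nat -> R) :
  jet r f c l -> jet r g c' l' -> jet r (fun d y => f d y + g d y) (c + c') (fun j => l j + l' j).
Proof.
intros Hf Hg; eapply vanishing_ext; [|exact (vanishing_plus _ _ _ _ Hf Hg)].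
intros d y; unfold linear_form; simpl; ring.
Qed.

Lemma jet_vanishing_0 (r : R) (f : R -> (nat -> R) -> R) (c : R) (l : nat -> R) :
  0 < r -> jet r f c l -> vanishing r 0 f.
Proof.
intros Hr Hf.
apply vanishing_ext with (fun d y => (f d y - (c + linear_form l y)) + (c + linear_form l y)).
{ intros; ring. }
apply vanishing_plus; [apply vanishing_weaken with 2%nat; auto; lia|].
apply (vanishing_plus _ _ (fun _ _ => c)); [apply vanishing_const|].
apply vanishing_weaken with 1%nat; [lia|apply vanishing_linear_form; auto].
Qed.

(** The remainder splits into the remainder of [f] times [g], the first-order part of [f] times the
    remainder of [g], and the product of the two linear forms; each has order 2. *)
Lemma jet_mult (r : R) (f g : R -> (nat -> R) -> R) (c c' : R) (l l' : nat -> R) :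
  0 < r -> jet r f c l -> jet r g c' l' ->
  jet r (fun d y => f d y * g d y) (c * c') (fun j => c * l' j + c' * l j).
Proof.
intros Hr Hf Hg.
apply vanishing_ext with (fun d y =>
  (f d y - (c + linear_form l y)) * g d y
  + ((c + linear_form l y) * (g d y - (c' + linear_form l' y))
     + linear_form l y * linear_form l' y)).
{ intros d y; unfold linear_form; ring. }
apply vanishing_plus; [|apply vanishing_plus].
- apply (vanishing_mult r 2 0); auto; apply (jet_vanishing_0 _ _ _ _ Hr Hg).
- apply (vanishing_mult r 0 2); auto.
  apply (vanishing_plus _ _ (fun _ _ => c)); [apply vanishing_const|].
  apply vanishing_weaken with 1%nat; [lia|apply vanishing_linear_form; auto].
- apply (vanishing_mult r 1 1); auto; apply vanishing_linear_form; auto.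
Qed.

Lemma jet_eq (r : R) (f : R -> (nat -> R) -> R) (c c' : R) (l l' : nat -> R) :
  c = c' -> (forall j, (j < 5)%nat -> l j = l' j) -> jet r f c l -> jet r f c' l'.
Proof.
intros <- Hl; apply vanishing_ext; intros d y; unfold linear_form.
rewrite !Hl by lia; reflexivity.
Qed.

Lemma jet_minus (r : R) (f g : R -> (nat -> R) -> R) (c c' : R) (l l' : nat -> R) :
  0 < r -> jet r f c l -> jet r g c' l' ->
  jet r (fun d y => f d y - g d y) (c - c') (fun j => l j - l' j).
Proof.
intros Hr Hf Hg.
eapply vanishing_ext; [|exact (vanishing_plus _ _ _ _ Hf (vanishing_scal _ (-1) _ _ Hr Hg))].
intros d y; unfold linear_form; simpl; ring.
Qed.

Lemma jet_pow (r : R) (f : R -> (nat -> R) -> R) (c : R) (l : nat -> R) (n : nat) :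
  0 < r -> jet r f c l ->
  jet r (fun d y => f d y ^ n) (c ^ n) (fun j => INR n * c ^ pred n * l j).
Proof.
intros Hr Hf; induction n as [|n IH].
- eapply jet_eq; [| |exact (jet_const r 1)]; [reflexivity|].
  intros j _; simpl; ring.
- eapply jet_eq; [| |exact (jet_mult _ _ _ _ _ _ _ Hr Hf IH)]; [reflexivity|].
  intros j _; rewrite S_INR; destruct n; simpl; ring.
Qed.

(* Minus [2 u^3 (1 + p^2)^(9/2)] times the left-hand side of the equation, for
   the values [u p q t w] of the unknown and its first four derivatives. *)
Definition willmore_poly (eps u p q t w : R) : R :=
  q * u * (1 + p ^ 2) ^ 3 - p ^ 2 * (1 + p ^ 2) ^ 3 - 2 * p ^ 2 * q * u * (1 + p ^ 2) ^ 2
  + q ^ 2 * u ^ 2 * (1 + p ^ 2) ^ 2 + 2 * p * t * u ^ 2 * (1 + p ^ 2) ^ 2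
  + u ^ 3 * w * (1 + p ^ 2) ^ 2 - 7 * p ^ 2 * q ^ 2 * u ^ 2 * (1 + p ^ 2)
  - 10 * u ^ 3 * p * q * t * (1 + p ^ 2) - 3 * u ^ 3 * q ^ 3 * (1 + p ^ 2)
  + 18 * u ^ 3 * p ^ 2 * q ^ 3 - / 2 * (1 + p ^ 2 - q * u) * (1 + p ^ 2 + q * u) ^ 2
  + 2 * eps * u ^ 2 * (1 + p ^ 2) ^ 3 * (1 + p ^ 2 - u * q).

(** What remains of the polynomial equation after the coefficient of the fourth derivative at the
    cylinder is normalized to 1 and the linearization is removed; [y i] stands for the [i]-th
    derivative of [v]. *)
Definition willmore_rem (alpha d : R) (y : nat -> R) : R :=
  / alpha ^ 3 * willmore_poly (/ (4 * alpha ^ 2) + d) (alpha + y 0%nat) (y 1%nat) (y 2%nat)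
                  (y 3%nat) (y 4%nat)
  - (y 4%nat + / alpha ^ 4 * y 0%nat).

(** The jet rules compute the constant and linear coefficients by following the syntax. The constant
    vanishes because the cylinder solves the equation at [/ (4 * alpha ^ 2)], the linear ones
    because the linearization there is [v'''' + v / alpha ^ 4]. *)
Lemma vanishing_willmore_rem (r alpha : R) :
  0 < r -> 0 < alpha -> vanishing r 2 (willmore_rem alpha).
Proof.
intros Hr Ha.
assert (H : exists c l, jet r (willmore_rem alpha) c l /\ c = 0 /\ forall j, (j < 5)%nat -> l j = 0).
{ do 2 eexists; split; [|split].
  - unfold willmore_rem, willmore_poly.
    repeat first
      [ apply jet_minus; [exact Hr| |]
      | apply jet_plus
      | apply jet_mult; [exact Hr| |]
      | apply jet_pow; [exact Hr|]
      | apply jet_var; lia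
      | apply jet_param
      | apply jet_const ].
  - simpl; field; lra.
  - intros j Hj; destruct j as [|[|[|[|[|j]]]]]; [| | | | |lia]; simpl; field; lra. }
destruct H as [c [l [H [Hc Hl]]]].
eapply vanishing_ext; [|exact H].
intros d y; unfold linear_form; rewrite Hc, !Hl by lia; ring.
Qed.

(** The fourth derivative is obtained algebraically from the linear equation. Indices above 4 repeat
    it, since [vanishing] asks for bounds at every index. *)
Definition state (kappa : R) (g : R -> R -> R) (i : nat) (d x : R) : R :=
  match i with
  | 0 | 1 | 2 | 3 => clamped kappa i g d x
  | _ => g d x - kappa * clamped kappa 0 g d x
  end.

Lemma bounded_op_state (r kappa : R) (i : nat) :
  1 < r -> 0 < kappa -> bounded_op r (fun g => state kappa g i).
Proof.
intros Hr Hk; destruct i as [|[|[|[|i]]]]; try (apply bounded_op_clamped; auto).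
assert (H : bounded_op r (fun g d x => g d x + - kappa * clamped kappa 0 g d x)).
{ apply (bounded_op_plus r (fun g => g)); [apply bounded_op_id|].
  apply bounded_op_scal; [lra|apply bounded_op_clamped; auto]. }
destruct H as [[C [HC H1]] H2]; split.
- exists C; split; auto; intros rho g M Hrho Hg.
  eapply normed_ext; [|apply (H1 _ _ _ Hrho Hg)]; intros; simpl; ring.
- intros rho g h M M' d x Hg Hh Hd Hx; specialize (H2 rho g h M M' d x Hg Hh Hd Hx).
  simpl; lra.
Qed.

Lemma bounded_state (r kappa : R) :
  1 < r -> 0 < kappa -> exists C, 1 <= C /\ forall i rho g M,
    0 < rho -> normed rho r g M -> normed rho r (state kappa g i) (C * M).
Proof.
intros Hr Hk.
destruct (proj1 (bounded_op_state r kappa 0 Hr Hk)) as [C0 [HC0 H0]].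
destruct (proj1 (bounded_op_state r kappa 1 Hr Hk)) as [C1 [HC1 H1]].
destruct (proj1 (bounded_op_state r kappa 2 Hr Hk)) as [C2 [HC2 H2]].
destruct (proj1 (bounded_op_state r kappa 3 Hr Hk)) as [C3 [HC3 H3]].
destruct (proj1 (bounded_op_state r kappa 4 Hr Hk)) as [C4 [HC4 H4]].
exists (1 + C0 + C1 + C2 + C3 + C4); split; [lra|].
intros i rho g M Hrho Hg.
assert (HM := normed_pos _ _ _ _ Hrho (Rlt_trans _ _ _ Rlt_0_1 Hr) Hg).
destruct i as [|[|[|[|i]]]].
- apply normed_le with (C0 * M); [nra|apply H0; auto].
- apply normed_le with (C1 * M); [nra|apply H1; auto].
- apply normed_le with (C2 * M); [nra|apply H2; auto].
- apply normed_le with (C3 * M); [nra|apply H3; auto].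
- apply normed_le with (C4 * M); [nra|apply H4; auto].
Qed.

Lemma state_parity (rho r kappa : R) (g : R -> R -> R) (M d x : R) (i : nat) :
  0 < kappa -> normed rho r g M -> even_on rho r g -> Rabs d < rho -> Rabs x < r -> (i < 5)%nat ->
  state kappa g i d (- x) = (-1) ^ i * state kappa g i d x.
Proof.
intros Hk Hg Heven Hd Hx Hi.
assert (H := fun j => clamped_parity rho r kappa j g M d x Hk Hg Hd Hx
          (fun y Hy => Heven d y Hd Hy)).
destruct i as [|[|[|[|i]]]]; try apply H.
destruct i; [|lia]; simpl; rewrite (H 0%nat), (Heven d x Hd Hx); simpl; ring.
Qed.

(** The equation is invariant under [x -> - x]: the odd-order derivatives [y 1] and [y 3] enter each
    monomial with even total degree. *)
Lemma willmore_rem_parity (alpha d : R) (y y' : nat -> R) :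
  (forall i, (i < 5)%nat -> y' i = (-1) ^ i * y i) -> willmore_rem alpha d y' = willmore_rem alpha d y.
Proof.
intros H; unfold willmore_rem, willmore_poly; rewrite !H by lia; simpl; ring.
Qed.

(** If [g] is minus the remainder along its own state, the linear part, which equals [g], cancels
    and the polynomial vanishes. The free bound [m] on [v] serves later for positivity of [u]. *)
Lemma willmore_solution (alpha r m : R) :
  0 < alpha -> 1 < r -> 0 < m ->
  exists rho g b, 0 < rho /\ normed rho r g b /\ even_on rho r g /\
    (forall d x, Rabs d < rho -> Rabs x < r -> Rabs (state (/ alpha ^ 4) g 0 d x) < m) /\
    forall d x, Rabs d < rho -> Rabs x < r ->
      willmore_poly (/ (4 * alpha ^ 2) + d) (alpha + state (/ alpha ^ 4) g 0 d x)
        (state (/ alpha ^ 4) g 1 d x) (state (/ alpha ^ 4) g 2 d x)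
        (state (/ alpha ^ 4) g 3 d x) (state (/ alpha ^ 4) g 4 d x) = 0.
Proof.
intros Ha Hr Hm.
set (kappa := / alpha ^ 4).
assert (Hk : 0 < kappa) by (apply Rinv_0_lt_compat, pow_lt; auto).
destruct (bounded_state r kappa Hr Hk) as [C [HC HT]].
destruct (vanishing_willmore_rem r alpha) as [C' [HC' HR]]; auto; [lra|].
(* Three requirements, with [eta = C * b]: contraction factor [C' * eta * C] at most 1/2,
   [eta <= 1], and [eta <= m / 2]. The [+ 1] guards against [C' = 0]. *)
set (b := Rmin (/ (2 * (C' + 1) * (C * C))) (Rmin (/ C) (m / (2 * C)))).
assert (HCC : 1 <= C * C) by nra.
assert (Hb : 0 < b).
{ repeat apply Rmin_pos; try apply Rdiv_lt_0_compat; try apply Rinv_0_lt_compat; try lra.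
  apply Rmult_lt_0_compat; lra. }
assert (Hb1 : b <= / (2 * (C' + 1) * (C * C))) by apply Rmin_l.
assert (Hb2 : b <= / C) by (eapply Rle_trans; [apply Rmin_r|apply Rmin_l]).
assert (Hb3 : b <= m / (2 * C)) by (eapply Rle_trans; [apply Rmin_r|apply Rmin_r]).
set (eta := C * b).
assert (He : 0 < eta <= 1).
{ split; [apply Rmult_lt_0_compat; lra|].
  apply Rmult_le_compat_l with (r := C) in Hb2; [|lra].
  rewrite Rinv_r in Hb2; [exact Hb2|lra]. }
assert (Hsmall : C' * eta * C <= / 2).
{ unfold eta; apply Rmult_le_compat_l with (r := (C' + 1) * (C * C)) in Hb1; [|nra].
  replace ((C' + 1) * (C * C) * / (2 * (C' + 1) * (C * C))) with (/ 2) in Hb1 by (field; lra).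
  assert (0 <= C * C * b) by (apply Rmult_le_pos; lra).
  nra. }
assert (Hrho : 0 < eta ^ 2) by (apply pow_lt; lra).
(* The largest parameter radius that [vanishing] admits for states of size [eta]. *)
set (rho := eta ^ 2) in Hrho.
assert (Hrho' : 0 < rho <= eta ^ 2) by (split; [exact Hrho|apply Rle_refl]).
set (Phi := fun g d x => - along (willmore_rem alpha) (state kappa g) d x).
assert (Hopp : forall f M, normed rho r f M -> normed rho r (fun d x => - f d x) M).
{ intros f M Hf; apply (normed_ext _ _ (fun d x => 0 - f d x)); [intros; ring|].
  replace M with (0 + M) by ring.
  apply (normed_minus _ _ (fun _ _ => 0)); auto; [lra|apply normed_zero; lra]. }
assert (Hst : forall g i, normed rho r g b -> normed rho r (state kappa g i) eta).
{ intros g i Hg; apply HT; auto. }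
destruct (normed_fixpoint rho r b Phi) as [g [Hg [Heven Hfix]]]; auto; [lra| | |].
- intros g Hg Heven; split.
  + assert (H0 : forall i, normed rho r (fun d x => state kappa g i d x - state kappa g i d x) 0).
    { intros i; apply (normed_ext _ _ (fun _ _ => 0)); [intros; ring|apply normed_zero; lra]. }
    destruct (HR eta rho 0 (state kappa g) (state kappa g) He) as [H _]; auto; try lra.
    apply Hopp; apply normed_le with (C' * eta ^ 2); [|exact H].
    (* One factor of [eta ^ 2] gives back [b], and what is left is the contraction factor: the same
       smallness yields the self-map and the contraction. *)
    replace (C' * eta ^ 2) with (C' * eta * C * b) by (unfold eta; ring).
    apply Rle_trans with (/ 2 * b); [apply Rmult_le_compat_r; lra|lra].
  + intros d x Hd Hx; unfold Phi, along; f_equal; apply willmore_rem_parity.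
    intros i Hi; apply (state_parity rho r kappa g b); auto.
- intros g h D HD Hg Hh Hgh.
  assert (Hdiff : forall i, normed rho r (fun d x => state kappa g i d x - state kappa h i d x) (C * D)).
  { intros i.
    apply (normed_ext _ _ (state kappa (fun d x => g d x - h d x) i)); [|apply HT; auto].
    intros d x Hd Hx; apply (proj2 (bounded_op_state r kappa i Hr Hk) rho g h b b); auto. }
  destruct (HR eta rho (C * D) (state kappa g) (state kappa h) He) as [_ H]; auto.
  { apply Rmult_le_pos; lra. }
  apply Hopp in H.
  apply normed_le with (C' * eta ^ pred 2 * (C * D)).
  + simpl pred; rewrite pow_1.
    replace (C' * eta * (C * D)) with (C' * eta * C * D) by ring.
    apply Rle_trans with (/ 2 * D); [apply Rmult_le_compat_r; lra|lra].
  + eapply normed_ext; [|exact H]; intros; unfold Phi; ring.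
- exists rho, g, b; repeat split; auto.
  + intros d x Hd Hx.
    apply Rle_lt_trans with eta; [apply (normed_bound rho r (state kappa g 0)); auto|].
    unfold eta; apply Rmult_le_compat_l with (r := C) in Hb3; [|lra].
    replace (C * (m / (2 * C))) with (m / 2) in Hb3 by (field; lra); lra.
  + intros d x Hd Hx; specialize (Hfix d x Hd Hx).
    unfold Phi, along, willmore_rem in Hfix.
    set (P := willmore_poly _ _ _ _ _ _) in Hfix |- *.
    change (/ alpha ^ 4) with kappa in Hfix.
    change (state kappa g 4 d x) with (g d x - kappa * clamped kappa 0 g d x) in Hfix.
    change (state kappa g 0 d x) with (clamped kappa 0 g d x) in Hfix.
    assert (HP : / alpha ^ 3 * P = 0) by lra.
    apply Rmult_integral in HP; destruct HP as [HP|HP]; auto.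
    exfalso; revert HP; apply Rinv_neq_0_compat, pow_nonzero; lra.
Qed.

(** * Joint smoothness *)

(** A bound is asked on every strictly smaller bidisc only, so the loss of radius in the Cauchy
    estimates is invisible and the class is stable under differentiation. *)
Definition analytic (rho r : R) (f : R -> R -> R) : Prop :=
  forall rho' r', 0 < rho' < rho -> 0 < r' < r -> exists M, normed rho' r' f M.

Lemma analytic_swap (rho r : R) (f : R -> R -> R) :
  analytic rho r f -> analytic r rho (fun x d => f d x).
Proof.
intros Hf r' rho' Hr Hrho; destruct (Hf rho' r' Hrho Hr) as [M HM].
exists M; apply normed_swap; auto.
Qed.

Lemma analytic_Derive_x (rho r : R) (f : R -> R -> R) :
  analytic rho r f -> analytic rho r (fun d x => Derive (f d) x).
Proof.
intros Hf rho' r' Hrho Hr.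
destruct (Hf rho' ((r' + r) / 2) Hrho) as [M HM]; [lra|].
exists (M / ((r' + r) / 2 - r')); apply (normed_Derive_x _ ((r' + r) / 2)); auto; lra.
Qed.

Lemma analytic_Derive_d (rho r : R) (f : R -> R -> R) :
  analytic rho r f -> analytic rho r (fun d x => Derive (fun s => f s x) d).
Proof.
intros Hf; apply (analytic_swap r rho (fun x d => Derive (fun s => f s x) d)).
apply (analytic_Derive_x r rho (fun x s => f s x)), analytic_swap; auto.
Qed.

Lemma analytic_local (rho r : R) (f : R -> R -> R) (d x : R) :
  analytic rho r f -> Rabs d < rho -> Rabs x < r ->
  exists rho' r' M, Rabs d < rho' /\ Rabs x < r' /\ normed rho' r' f M.
Proof.
intros Hf Hd Hx; assert (H1 := Rabs_pos d); assert (H2 := Rabs_pos x).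
destruct (Hf ((Rabs d + rho) / 2) ((Rabs x + r) / 2)) as [M HM]; [lra|lra|].
exists ((Rabs d + rho) / 2), ((Rabs x + r) / 2), M; repeat split; auto; lra.
Qed.

Lemma analytic_is_derive_x (rho r : R) (f : R -> R -> R) (d x : R) :
  analytic rho r f -> Rabs d < rho -> Rabs x < r -> is_derive (f d) x (Derive (f d) x).
Proof.
intros Hf Hd Hx; destruct (analytic_local _ _ _ _ _ Hf Hd Hx) as [rho' [r' [M [Hd' [Hx' HM]]]]].
apply (Derive_correct (f d)), (normed_ex_derive_x _ _ _ _ _ _ HM); auto.
Qed.

Lemma analytic_lipschitz (rho r : R) (f : R -> R -> R) (d x : R) :
  analytic rho r f -> Rabs d < rho -> Rabs x < r ->
  exists e L, 0 < e /\ forall d' x', Rabs (d' - d) < e -> Rabs (x' - x) < e ->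
    Rabs (f d' x' - f d x) <= L * (Rabs (d' - d) + Rabs (x' - x)).
Proof.
intros Hf Hd Hx; destruct (analytic_local _ _ _ _ _ Hf Hd Hx) as [rho' [r' [M [Hd' [Hx' HM]]]]].
assert (H1 := Rabs_pos d); assert (H2 := Rabs_pos x).
set (e := Rmin ((rho' - Rabs d) / 2) ((r' - Rabs x) / 2)).
assert (He : 0 < e) by (apply Rmin_pos; lra).
assert (He1 : e <= (rho' - Rabs d) / 2) by apply Rmin_l.
assert (He2 : e <= (r' - Rabs x) / 2) by apply Rmin_r.
exists e, (M / (rho' - (Rabs d + e)) + M / (r' - (Rabs x + e))); split; auto.
intros d' x' Hdd Hxx.
assert (HMp : 0 <= M) by (apply (normed_pos rho' r' f); auto; lra).
assert (Hd0 : Rabs d' <= Rabs d + e).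
{ replace d' with (d + (d' - d)) by ring; eapply Rle_trans; [apply Rabs_triang|lra]. }
assert (Hx0 : Rabs x' <= Rabs x + e).
{ replace x' with (x + (x' - x)) by ring; eapply Rle_trans; [apply Rabs_triang|lra]. }
assert (Hfx := normed_lipschitz_x rho' r' (Rabs x + e) f M d' x' x).
assert (Hfd := normed_lipschitz_x r' rho' (Rabs d + e) (fun x d => f d x) M x d' d).
cbv beta in Hfd.
assert (Hq1 : 0 <= M / (rho' - (Rabs d + e))) by (apply Rdiv_le_0_compat; lra).
assert (Hq2 : 0 <= M / (r' - (Rabs x + e))) by (apply Rdiv_le_0_compat; lra).
assert (Hfx' : Rabs (f d' x' - f d' x) <= Rabs (x' - x) * (M / (r' - (Rabs x + e))))
  by (apply Hfx; auto; lra).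
assert (Hfd' : Rabs (f d' x - f d x) <= Rabs (d' - d) * (M / (rho' - (Rabs d + e))))
  by (apply Hfd; try apply normed_swap; auto; lra).
replace (f d' x' - f d x) with ((f d' x' - f d' x) + (f d' x - f d x)) by ring.
eapply Rle_trans; [apply Rabs_triang|].
assert (P1 := Rabs_pos (d' - d)); assert (P2 := Rabs_pos (x' - x)).
assert (P3 := Rmult_le_pos _ _ P1 Hq2); assert (P4 := Rmult_le_pos _ _ P2 Hq1).
lra.
Qed.

Fixpoint partial (f : R -> R -> R) (w : list bool) : R -> R -> R :=
  match w with
  | nil => f
  | true :: w => fun d x => Derive (partial f w d) x
  | false :: w => fun d x => Derive (fun s => partial f w s x) d
  end.

Lemma analytic_partial (rho r : R) (f : R -> R -> R) (w : list bool) :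
  analytic rho r f -> analytic rho r (partial f w).
Proof.
intros Hf; induction w as [|[|] w IH]; simpl; auto.
- apply analytic_Derive_x; auto.
- apply analytic_Derive_d; auto.
Qed.

(** An ordinary derivative restricts to any subset [P]; this supplies the one-sided derivatives at
    the endpoints. *)
Lemma is_derive_quotient_within (g : R -> R) (x l : R) (P : R -> Prop) :
  is_derive g x l ->
  filterlim (fun y => (g y - g x) / (y - x))
    (within (fun y => P y /\ y <> x) (locally x)) (locally l).
Proof.
intros Hg; apply is_derive_Reals in Hg; apply filterlim_locally; intros eps.
destruct (Hg eps (cond_pos eps)) as [e He].
exists e; intros y Hy [_ Hne].
assert (Hne' : y - x <> 0) by lra.
specialize (He (y - x) Hne' Hy).
rewrite Rplus_minus in He; exact He.
Qed.

(** All iterated partial derivatives remain [analytic] on the same open bidisc, so a single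
    Lipschitz estimate and a single differentiability fact settle every order; [1 < r] places the
    closed interval inside. *)
Lemma Cinf2_on_analytic (e0 rho r : R) (f : R -> R -> R) :
  1 < r -> analytic rho r f ->
  Cinf2_on (fun e x => e0 - rho < e < e0 + rho /\ -1 <= x <= 1) (fun e x => f (e - e0) x).
Proof.
intros Hr Hf; exists (fun w e x => partial f w (e - e0) x).
assert (Hin : forall e x, e0 - rho < e < e0 + rho /\ -1 <= x <= 1 ->
          Rabs (e - e0) < rho /\ Rabs x < r).
{ intros e x [He Hx]; split; apply Rabs_def1; lra. }
split; [reflexivity|split; [|split]].
- intros w e x He; destruct (Hin e x He) as [Hd Hx].
  destruct (analytic_lipschitz rho r (partial f w) (e - e0) x) as [h [L [Hh HL]]]; auto.
  { apply analytic_partial; auto. }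
  apply filterlim_locally; intros eps.
  assert (HL1 : 0 < Rabs L + 1) by (assert (H := Rabs_pos L); lra).
  assert (Hm : 0 < Rmin h (eps / (2 * (Rabs L + 1)))).
  { apply Rmin_pos; auto; apply Rdiv_lt_0_compat; [apply cond_pos|lra]. }
  exists (mkposreal _ Hm); intros [e' x'] [He' Hx'] _; simpl in He', Hx'; simpl.
  change (Rabs (e' - e) < Rmin h (eps / (2 * (Rabs L + 1)))) in He'.
  change (Rabs (x' - x) < Rmin h (eps / (2 * (Rabs L + 1)))) in Hx'.
  change (Rabs (partial f w (e' - e0) x' - partial f w (e - e0) x) < eps).
  assert (He1 := Rlt_le_trans _ _ _ He' (Rmin_l _ _)).
  assert (He2 := Rlt_le_trans _ _ _ He' (Rmin_r _ _)).
  assert (Hx1 := Rlt_le_trans _ _ _ Hx' (Rmin_l _ _)).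
  assert (Hx2 := Rlt_le_trans _ _ _ Hx' (Rmin_r _ _)).
  replace (e' - e) with (e' - e0 - (e - e0)) in He1, He2 by ring.
  eapply Rle_lt_trans; [apply HL; auto|].
  set (z := Rabs (e' - e0 - (e - e0)) + Rabs (x' - x)).
  assert (Hz : z < eps / (Rabs L + 1)).
  { replace (eps / (Rabs L + 1)) with (eps / (2 * (Rabs L + 1)) + eps / (2 * (Rabs L + 1)))
      by (field; lra).
    unfold z; lra. }
  assert (Hz0 : 0 <= z) by (apply Rplus_le_le_0_compat; apply Rabs_pos).
  apply Rmult_lt_compat_r with (r := Rabs L + 1) in Hz; auto.
  unfold Rdiv in Hz; rewrite Rmult_assoc, Rinv_l, Rmult_1_r in Hz by lra.
  assert (HLe := Rle_abs L); nra.
- intros w e x He; destruct (Hin e x He) as [Hd Hx].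
  apply (is_derive_quotient_within (fun y => partial f w (e - e0) y)).
  apply (analytic_is_derive_x rho r (partial f w)); auto; apply analytic_partial; auto.
- intros w e x He; destruct (Hin e x He) as [Hd Hx].
  apply (is_derive_quotient_within (fun s => partial f w (s - e0) x)).
  simpl.
  assert (H : is_derive (fun s => partial f w s x) (e - e0)
                (Derive (fun s => partial f w s x) (e - e0))).
  { apply (analytic_is_derive_x r rho (fun x s => partial f w s x)); auto.
    apply analytic_swap, analytic_partial; auto. }
  replace (Derive (fun s => partial f w s x) (e - e0))
    with (scal 1 (Derive (fun s => partial f w s x) (e - e0)))
    by (unfold scal; simpl; unfold mult; simpl; ring).
  apply (is_derive_comp (fun s => partial f w s x) (fun s => s - e0)); auto.
  auto_derive; auto; ring.
Qed.

(** * The equation in polynomial form *)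

Lemma Derive_on (f f' : R -> R) (r : R) :
  (forall x, Rabs x < r -> is_derive f x (f' x)) -> forall x, Rabs x < r -> Derive f x = f' x.
Proof. intros H x Hx; apply is_derive_unique; auto. Qed.

Lemma is_derive_ext_on (f g : R -> R) (r x l : R) :
  (forall y, Rabs y < r -> f y = g y) -> Rabs x < r -> is_derive f x l -> is_derive g x l.
Proof.
intros Hfg Hx; apply is_derive_ext_loc.
destruct (Rabs_lt_nbhd x r Hx) as [He Hn].
exists (mkposreal _ He); intros y Hy; apply Hfg.
replace y with (x + (y - x)) by ring; apply Hn; exact Hy.
Qed.

(** Named derivatives on an open interval replace nested [Derive], whose value carries information
    only where differentiability is known. *)
Definition deriv_chain (r : R) (u p q t w : R -> R) : Prop :=
  forall x, Rabs x < r ->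
    is_derive u x (p x) /\ is_derive p x (q x) /\ is_derive q x (t x) /\ is_derive t x (w x).

Lemma sqrt_one_plus_sqr (a : R) :
  0 < sqrt (1 + a ^ 2) /\ sqrt (1 + a ^ 2) ^ 2 = 1 + a ^ 2.
Proof.
assert (H := pow2_ge_0 a); split; [apply sqrt_lt_R0; lra|].
apply pow2_sqrt; lra.
Qed.

Lemma Derive2_on (r : R) (u p q : R -> R) (x : R) :
  (forall y, Rabs y < r -> is_derive u y (p y)) -> Rabs x < r -> is_derive p x (q x) ->
  Derive (Derive u) x = q x.
Proof.
intros Hu Hx Hp; apply is_derive_unique, (is_derive_ext_on p _ r); auto.
intros y Hy; symmetry; apply (Derive_on u p r); auto.
Qed.

Definition curv (u p q : R -> R) (x : R) : R :=
  / 2 * (/ (u x * sqrt (1 + p x ^ 2)) - q x / sqrt (1 + p x ^ 2) ^ 3).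

Lemma mean_curv_on (r : R) (u p q t w : R -> R) (x : R) :
  deriv_chain r u p q t w -> Rabs x < r -> mean_curv u x = curv u p q x.
Proof.
intros H Hx; unfold mean_curv, curv.
rewrite (Derive2_on r u p q), (Derive_on u p r) by first [apply H; auto | auto; intros; apply H; auto].
reflexivity.
Qed.

Ltac derive_chain :=
  repeat match goal with
  | H : is_derive ?f ?y ?l |- context [Derive (fun z => ?f z) ?y] =>
      replace (Derive (fun z => f z) y) with l by (symmetry; exact (is_derive_unique _ _ _ H))
  end.

Lemma is_derive_curv (r : R) (u p q t w : R -> R) (x : R) :
  deriv_chain r u p q t w -> 0 < u x -> Rabs x < r ->
  is_derive (curv u p q) x
    (/ 2 * (- p x / (u x ^ 2 * sqrt (1 + p x ^ 2)) - p x * q x / (u x * sqrt (1 + p x ^ 2) ^ 3)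
            - t x / sqrt (1 + p x ^ 2) ^ 3 + 3 * q x ^ 2 * p x / sqrt (1 + p x ^ 2) ^ 5)).
Proof.
intros Hc Hux Hx; destruct (Hc x Hx) as [Hu [Hp [Hq Ht]]]; unfold curv.
 destruct (sqrt_one_plus_sqr (p x)) as [HS _].
assert (H := pow2_ge_0 (p x)).
assert (HS1 : 0 < 1 + p x * (p x * 1)) by (simpl in H; lra).
assert (HS' : 0 < sqrt (1 + p x * (p x * 1))) by (simpl in HS; auto).
auto_derive.
- repeat split; auto.
  + eexists; exact Hu.
  + eexists; exact Hp.
  + apply Rgt_not_eq, Rmult_lt_0_compat; auto.
  + eexists; exact Hq.
  + eexists; exact Hp.
  + apply Rgt_not_eq; repeat apply Rmult_lt_0_compat; auto; lra.
- derive_chain.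
  simpl; field; split; lra.
Qed.

(** The quantity [u H' / sqrt (1 + u' ^ 2)]. Only even powers of the root survive in it, so the last
    differentiation concerns a rational expression. *)
Definition flux (u p q t : R -> R) (x : R) : R :=
  / 2 * (- p x / (u x * (1 + p x ^ 2)) - p x * q x / (1 + p x ^ 2) ^ 2
         - u x * t x / (1 + p x ^ 2) ^ 2 + 3 * u x * p x * q x ^ 2 / (1 + p x ^ 2) ^ 3).

Lemma flux_on (r : R) (u p q t w : R -> R) (x : R) :
  deriv_chain r u p q t w -> 0 < u x -> Rabs x < r ->
  u x / sqrt (1 + Derive u x ^ 2) * Derive (mean_curv u) x = flux u p q t x.
Proof.
intros Hc Hux Hx; rewrite (is_derive_unique _ _ _ (proj1 (Hc x Hx))).
erewrite (is_derive_unique (mean_curv u));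
  [|apply (is_derive_ext_on (curv u p q) _ r); [|exact Hx|apply (is_derive_curv r u p q t w); auto];
    intros y Hy; symmetry; apply (mean_curv_on r u p q t w); auto].
unfold flux; destruct (sqrt_one_plus_sqr (p x)) as [HS HS2].
set (S := sqrt (1 + p x ^ 2)) in *; clearbody S.
rewrite <- HS2; field; lra.
Qed.

(** Links the polynomial to the equation itself: the denominator is positive where [u] is, so a zero
    of the polynomial is a zero of the left-hand side. *)
Lemma willmore_lhs_poly (r : R) (u p q t w : R -> R) (eps x : R) :
  deriv_chain r u p q t w -> (forall y, Rabs y < r -> 0 < u y) -> Rabs x < r ->
  willmore_lhs eps u x =
  - willmore_poly eps (u x) (p x) (q x) (t x) (w x)
    / (2 * u x ^ 3 * (1 + p x ^ 2) ^ 4 * sqrt (1 + p x ^ 2)).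
Proof.
intros Hc Hpos Hx; unfold willmore_lhs; cbv zeta.
assert (Hux := Hpos x Hx); destruct (sqrt_one_plus_sqr (p x)) as [HS HS2].
assert (H2 := pow2_ge_0 (p x)).
assert (Hflux : Derive (fun y => u y / sqrt (1 + Derive u y ^ 2) * Derive (mean_curv u) y) x
  = Derive (flux u p q t) x).
{ apply Derive_ext_loc.
  destruct (Rabs_lt_nbhd x r Hx) as [He Hn].
  exists (mkposreal _ He); intros y Hy; assert (Hy' : Rabs y < r).
  { replace y with (x + (y - x)) by ring; apply Hn; exact Hy. }
  apply (flux_on r u p q t w); auto. }
destruct (Hc x Hx) as [Hu [Hp [Hq Ht]]].
assert (Hu' : forall y, Rabs y < r -> is_derive u y (p y)) by (intros y Hy; apply Hc; auto).
rewrite Hflux, (mean_curv_on r u p q t w), (Derive2_on r u p q), (is_derive_unique _ _ _ Hu) by auto.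
assert (HD : is_derive (flux u p q t) x (/ 2 * (
   - q x / (u x * (1 + p x ^ 2)) + p x ^ 2 / (u x ^ 2 * (1 + p x ^ 2))
   + 2 * p x ^ 2 * q x / (u x * (1 + p x ^ 2) ^ 2)
   - (q x ^ 2 + 2 * p x * t x + u x * w x) / (1 + p x ^ 2) ^ 2
   + (7 * p x ^ 2 * q x ^ 2 + 10 * u x * p x * q x * t x + 3 * u x * q x ^ 3) / (1 + p x ^ 2) ^ 3
   - 18 * u x * p x ^ 2 * q x ^ 3 / (1 + p x ^ 2) ^ 4))).
{ assert (HS1 : 0 < 1 + p x * (p x * 1)) by (simpl in H2; lra).
  unfold flux; auto_derive.
  - repeat split; try (eexists; exact Hu); try (eexists; exact Hp);
      try (eexists; exact Hq); try (eexists; exact Ht);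
      apply Rgt_not_eq; repeat apply Rmult_lt_0_compat; auto; lra.
  - derive_chain.
    simpl; field; simpl in *; split; lra. }
rewrite (is_derive_unique _ _ _ HD).
unfold curv, willmore_poly; clear Hflux HD.
(* The root becomes an indeterminate subject only to [p x ^ 2 = S ^ 2 - 1], and the claim an
   identity of rational functions. *)
set (S := sqrt (1 + p x ^ 2)) in *; clearbody S.
assert (Hp2 : p x ^ 2 = S ^ 2 - 1) by lra.
rewrite <- HS2; field [Hp2]; lra.
Qed.

(** * The family of solutions *)

Lemma is_derive_state (rho r kappa : R) (i : nat) (g : R -> R -> R) (M d x : R) :
  0 < kappa -> normed rho r g M -> Rabs d < rho -> Rabs x < r -> (i < 4)%nat ->
  is_derive (state kappa g i d) x (state kappa g (S i) d x).
Proof.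
intros Hk Hg Hd Hx Hi.
destruct i as [|[|[|[|i]]]]; [| | | |lia].
1-3: apply (is_derive_clamped rho r _ _ _ M); auto; lia.
apply (is_derive_clamped_3 rho r _ _ M); auto.
Qed.

Theorem theorem4p1 :
  forall alpha : R, 0 < alpha ->
  let eps_alpha := / (4 * alpha ^ 2) in
  exists delta : R, 0 < delta /\
  exists u : R -> R -> R,
    Cinf2_on (fun e x => eps_alpha - delta < e < eps_alpha + delta /\ -1 <= x <= 1) u /\
    forall eps, eps_alpha - delta < eps < eps_alpha + delta ->
      in_N_alpha_Cinf alpha (u eps) /\
      forall x, -1 < x < 1 -> willmore_lhs eps (u eps) x = 0.
Proof.
intros alpha Ha eps_alpha.
assert (H12 : 1 < 2) by lra.
(* Any radius above 1 would serve in place of 2. The second [alpha] is the smallness [m]: from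
   [Rabs v < alpha] follows [alpha + v > 0]. *)
destruct (willmore_solution alpha 2 alpha Ha H12 Ha)
  as [rho [g [b [Hrho [Hg [Heven [Hsmall Hsol]]]]]]].
fold eps_alpha in Hsol.
set (kappa := / alpha ^ 4) in *.
assert (Hk : 0 < kappa) by (apply Rinv_0_lt_compat, pow_lt; auto).
exists rho; split; auto.
set (f := fun d x => alpha + state kappa g 0 d x).
assert (Hf : analytic rho 2 f).
{ intros rho' r' Hrho' Hr'.
  destruct (bounded_state 2 kappa H12 Hk) as [C [_ HC]].
  exists (Rabs alpha + C * b); apply (normed_restrict rho 2); try lra.
  apply (normed_plus _ _ (fun _ _ => alpha)); [apply normed_const|apply HC; auto]. }
exists (fun e x => f (e - eps_alpha) x); split.
{ apply (Cinf2_on_analytic eps_alpha rho 2); auto. }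
intros eps Heps.
assert (Hd : Rabs (eps - eps_alpha) < rho) by (apply Rabs_def1; lra).
set (d := eps - eps_alpha) in *.
assert (Hder : forall i x, Rabs x < 2 -> (i < 4)%nat ->
  is_derive (state kappa g i d) x (state kappa g (S i) d x)).
{ intros i x Hx Hi; apply (is_derive_state rho 2 _ _ _ b); auto. }
assert (Hder0 : forall x, Rabs x < 2 -> is_derive (f d) x (state kappa g 1 d x)).
{ intros x Hx; unfold f.
  rewrite <- (plus_zero_l (state kappa g 1 d x)).
  apply (is_derive_plus (fun _ => alpha)); [|apply Hder; auto; lia].
  exact (is_derive_const alpha x). }
assert (HI : forall x, I11 x -> Rabs x < 2) by (intros x [H1 H2]; apply Rabs_def1; lra).
assert (Hpos : forall x, Rabs x < 2 -> 0 < f d x).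
{ intros x Hx; specialize (Hsmall d x Hd Hx); apply Rabs_def2 in Hsmall; unfold f; lra. }
assert (Hm1 : Rabs 1 < 2) by (rewrite Rabs_R1; lra).
assert (Hpar : forall i x, Rabs x < 2 -> (i < 5)%nat ->
  state kappa g i d (- x) = (-1) ^ i * state kappa g i d x).
{ intros i x Hx Hi; apply (state_parity rho 2 _ _ b); auto. }
assert (Hb : forall i, (i < 2)%nat -> state kappa g i d 1 = 0).
{ intros [|[|i]] Hi; [| |lia]; apply clamped_boundary; auto. }
assert (Hb' : forall i, (i < 2)%nat -> state kappa g i d (-1) = 0).
{ intros i Hi; replace (-1) with (- (1)) by ring.
  rewrite Hpar, Hb by (auto; lia); ring. }
split.
- exists (fun n => partial f (repeat true n) d); split; [split; [reflexivity|]|].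
  { intros n x Hx.
    apply (is_derive_quotient_within (partial f (repeat true n) d) x _ I11).
    apply (analytic_is_derive_x rho 2 (partial f (repeat true n))); auto.
    apply analytic_partial; auto. }
  split; [|split; [|split; [|split; [|split]]]].
  + intros x Hx; unfold f; rewrite Hpar by (auto; lia); simpl; ring.
  + intros x Hx; apply Hpos; auto.
  + unfold f; rewrite Hb by lia; ring.
  + unfold f; rewrite Hb' by lia; ring.
  + simpl; rewrite (is_derive_unique _ _ _ (Hder0 1 Hm1)); apply Hb; lia.
  + simpl; assert (Hm : Rabs (-1) < 2) by (apply Rabs_def1; lra).
    rewrite (is_derive_unique _ _ _ (Hder0 (-1) Hm)); apply Hb'; lia.
- intros x Hx.
  assert (Hx' : Rabs x < 2) by (apply Rabs_def1; lra).
  change (willmore_lhs eps (f d) x = 0).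
  rewrite (willmore_lhs_poly 2 (f d) (state kappa g 1 d) (state kappa g 2 d)
             (state kappa g 3 d) (state kappa g 4 d)); auto.
  2: { intros y Hy.
       assert (H1 := Hder 1%nat y Hy); assert (H2 := Hder 2%nat y Hy);
       assert (H3 := Hder 3%nat y Hy).
       split; [exact (Hder0 y Hy)|split; [|split]]; [apply H1|apply H2|apply H3]; lia. }
  replace eps with (eps_alpha + d) by (unfold d; ring).
  unfold f; rewrite Hsol by auto; unfold Rdiv; ring.
Qed.
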